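(* If $(A,C)$ is exponentially detectable, then there exists a non-negative self-adjoint operator $P\in L(\mathcal H)$ for which there exist $\eta,m>0$ such that for all $x\in\operatorname{dom}A$ $$\|Cx\|^2-2\eta\operatorname{Re}\langle Ax,Px\rangle\ \ge\ m\|x\|^2 .\qquad( * )$$ Conversely, if there are a non-negative self-adjoint operator $P\in L(\mathcal H)$ with $\operatorname{ran}C^*\subset\operatorname{ran}P$ and constants $\eta,m>0$ such that $( * )$ holds for all $x\in\operatorname{dom}A$, then $(A,C)$ is exponentially detectable.
   Context: Setting: $\mathcal H,\mathcal Y$ are Hilbert spaces (real or complex, over the same field), $A$ generates a $C_0$-semigroup on $\mathcal H$, and $C\in L(\mathcal H,\mathcal Y)$ is a bounded linear operator. A self-adjoint $P\in L(\mathcal H)$ is non-negative if $\langle Px,x\rangle\ge0$ for all $x\in\mathcal H$. An operator is called exponentially stable if it generates an exponentially stable $C_0$-semigroup $T(\cdot)$ on $\mathcal H$, i.e., $T(\cdot)x\in L^2([0,\infty),\mathcal H)$ for each $x\in\mathcal H$. The pair $(A,C)$ is called exponentially detectable if there exists $F\in L(\mathcal Y,\mathcal H)$ such that $A+FC$ is exponentially stable. *)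

(* Defs.v *)
From HB Require Import structures.
From mathcomp Require Import all_boot all_order all_algebra.
From mathcomp Require Import complex.
From mathcomp Require Import all_classical all_reals all_analysis.

Set Implicit Arguments.
Unset Strict Implicit.
Unset Printing Implicit Defensive.

Import Order.TTheory GRing.Theory Num.Theory.
Import numFieldNormedType.Exports.

Local Open Scope classical_set_scope.
Local Open Scope ring_scope.

Variant scalars := RealScalars | ComplexScalars.

Definition scalar_field (R : realType) (k : scalars) : numFieldType :=
  match k with RealScalars => R | ComplexScalars => R[i] end.

Definition sconj (R : realType) (k : scalars) :
    scalar_field R k -> scalar_field R k :=
  match k with RealScalars => idfun | ComplexScalars => @Num.conj R[i] end.

Definition sRe (R : realType) (k : scalars) : scalar_field R k -> R :=
  match k with RealScalars => idfun | ComplexScalars => @complex.Re R end.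

Definition sreal (R : realType) (k : scalars) : R -> scalar_field R k :=
  match k with RealScalars => idfun | ComplexScalars => real_complex R end.

(* The inner product is linear in its first argument and conjugate-linear in
   its second one. *)
HB.mixin Record NormedModule_isHilbert (R : realType) (k : scalars) (H : Type)
    of CompleteNormedModule (scalar_field R k) H := {
  inner : {dot H for @sconj R k} ;
  inner_normE : forall x : H, `|x| ^+ 2 = inner x x
}.

#[short(type="hilbertType")]
HB.structure Definition Hilbert (R : realType) (k : scalars) :=
  {H of NormedModule_isHilbert R k H & CompleteNormedModule (scalar_field R k) H}.

Notation "''[' x , y ]" := (inner x y) (at level 0) : ring_scope.

(* The library's norm takes its values in the scalar field; [hnorm] is the same
   norm with values in [R]. *)
Definition hnorm (R : realType) (k : scalars) (H : hilbertType R k) (x : H) : R :=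
  sRe `|x|.

Record bounded_op (R : realType) (k : scalars) (H Y : hilbertType R k) :=
  BoundedOp {
    bop :> {linear H -> Y} ;
    bop_bounded : bounded_near bop (nbhs (0 : H)) }.

Notation "''L' ( H , Y )" := (bounded_op H Y)
  (at level 8, format "''L' ( H ,  Y )") : type_scope.

(* By the Riesz representation theorem exactly one [z] qualifies, so the default
   value [0] is never used. *)
Definition adjoint (R : realType) (k : scalars) (H Y : hilbertType R k)
    (C : 'L(H, Y)) (y : Y) : H :=
  xget 0 [set z : H | forall x : H, '[C x, y] = '[x, z]].

Definition self_adjoint (R : realType) (k : scalars) (H : hilbertType R k)
    (P : 'L(H, H)) : Prop :=
  adjoint P =1 P.

Definition nonneg_op (R : realType) (k : scalars) (H : hilbertType R k)
    (P : 'L(H, H)) : Prop :=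
  forall x : H, 0 <= '[P x, x].

(* A possibly unbounded operator; the values of [uop] outside of [dom] are
   irrelevant, and linearity is not required since it is automatic for the
   generator of a semigroup. *)
Record unbounded_op (R : realType) (k : scalars) (H : hilbertType R k) :=
  UnboundedOp { dom : set H ; uop :> H -> H }.

Definition perturb (R : realType) (k : scalars) (H : hilbertType R k)
    (A : unbounded_op H) (B : H -> H) : unbounded_op H :=
  UnboundedOp (dom A) (fun x => A x + B x).

(* Only the values of [T] at nonnegative times are relevant. *)
Definition C0_semigroup (R : realType) (k : scalars) (H : hilbertType R k)
    (T : R -> 'L(H, H)) : Prop :=
  [/\ forall x, T 0 x = x,
      forall s t, 0 <= s -> 0 <= t -> forall x, T (s + t) x = T s (T t x) &
      forall x, T t x @[t --> 0^'+] --> x].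

Definition difference_quotient (R : realType) (k : scalars)
    (H : hilbertType R k) (T : R -> 'L(H, H)) (x : H) (t : R) : H :=
  (sreal k t)^-1 *: (T t x - x).

Definition generates (R : realType) (k : scalars) (H : hilbertType R k)
    (A : unbounded_op H) (T : R -> 'L(H, H)) : Prop :=
  dom A = [set x | cvg (difference_quotient T x t @[t --> 0^'+])] /\
  forall x, dom A x -> difference_quotient T x t @[t --> 0^'+] --> A x.

(* Membership of [f] in L^2([0, +oo[, H) for a continuous [f], such as an orbit
   of a C0-semigroup: strong measurability of [f] is then automatic. *)
Definition square_integrable (R : realType) (k : scalars) (H : hilbertType R k)
    (f : R -> H) : Prop :=
  lebesgue_measure.-integrable `[0%R, +oo[ (fun t => (hnorm (f t) ^+ 2)%:E).

Definition exponentially_stable (R : realType) (k : scalars)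
    (H : hilbertType R k) (A : unbounded_op H) : Prop :=
  exists T : R -> 'L(H, H),
    [/\ C0_semigroup T, generates A T &
        forall x : H, square_integrable (fun t => T t x)].

Definition exponentially_detectable (R : realType) (k : scalars)
    (H Y : hilbertType R k) (A : unbounded_op H) (C : 'L(H, Y)) : Prop :=
  exists F : 'L(Y, H), exponentially_stable (perturb A (F \o C)).

Definition detectability_inequality (R : realType) (k : scalars)
    (H Y : hilbertType R k) (A : unbounded_op H) (C : 'L(H, Y))
    (P : 'L(H, H)) (eta m : R) : Prop :=
  forall x : H, dom A x ->
    hnorm (C x) ^+ 2 - 2 * eta * sRe '[A x, P x] >= m * hnorm x ^+ 2.

(* Main.v *)
Require Import Defs.
From HB Require Import structures.
From mathcomp Require Import all_boot all_order all_algebra.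
From mathcomp Require Import complex ring lra.
From mathcomp Require Import all_classical all_reals all_analysis.
From mathcomp Require Import measurable_realfun.

(** Both directions rest on the Lyapunov inequality
    [2 Re <(A + F C) x, P x> <= - c |x|^2] on the domain of [A], for a feedback
    [F] and a constant [c > 0].

    From detectability to the inequality.  Let [T] be the exponentially stable
    semigroup generated by [A + F C].  The form [b(x, y)], the integral over
    [t >= 0] of [<T(t) x, T(t) y>], is finite by assumption.  Its quadratic form
    is lower semicontinuous by Fatou, hence bounded by a Baire category argument
    ([uniform_boundedness]), and the Riesz theorem turns [b] into a bounded
    non-negative self-adjoint operator [P].  As [b(T(t) x, T(t) x)] is the
    integral of [|T(s) x|^2] over [s >= t], differentiating at [t = 0] gives
    [2 Re <(A + F C) x, P x> <= - |x|^2] on the domain ([lyapunov_operator]).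
    Young's inequality moves the bounded term [<F C x, P x>] into [|C x|^2].

    From the inequality to detectability.  The inclusion of ranges gives, by
    Baire once more, a constant [K] with [|<C w, y>| <= K |P w| |y|].
    So there is a bounded [G] with [P G = C^*]
    ([douglas_factor]).  For [F = - (2 eta)^-1 G] the term [2 eta Re <F C x, P x>]
    equals [- |C x|^2], and the inequality says precisely that
    [2 eta Re <(A + F C) x, P x> <= - m |x|^2].  The operator [A + F C] generates
    a semigroup [S] because bounded perturbations of generators do
    ([bounded_perturbation]); along its orbits in the domain, [<P S(t) x, S(t) x>]
    decreases at rate at least [(m / eta) |S(t) x|^2], so the integral of
    [|S(t) x|^2] is at most [(eta / m) <P x, x>].  Density of the domain extends
    this to all [x] ([dissipative_exponentially_stable]).

    The perturbation theorem is proved by solving Duhamel's equation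
    [S(t) x = T(t) x + int_0^t T(t - s) B S(s) x ds] by Picard iteration: the
    integral operator halves the norm with weight [e^(- lam t)] on a bounded
    interval when [lam] is large.  Uniqueness yields linearity and the semigroup
    law; the integral has derivative [B x] at [t = 0], so that both generators
    have the same domain and differ by [B].

    Both scalar fields are treated at once by working in the real Hilbert space
    with inner product [Re <x, y>] ([rdot]).  Vector-valued integrals of
    continuous functions are defined weakly, through the Riesz theorem. *)

Set Implicit Arguments.
Unset Strict Implicit.
Unset Printing Implicit Defensive.

Import Order.TTheory GRing.Theory Num.Theory.
Import numFieldNormedType.Exports.

Local Open Scope classical_set_scope.
Local Open Scope ring_scope.

(** * Real and complex scalars *)

Section Scalars.
Context (R : realType) (k : scalars).
Implicit Types (a b : R) (c d : scalar_field R k).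

Lemma srealD a b : sreal k (a + b) = sreal k a + sreal k b.
Proof. by case: k => //=; rewrite rmorphD. Qed.

Lemma srealM a b : sreal k (a * b) = sreal k a * sreal k b.
Proof. by case: k => //=; rewrite rmorphM. Qed.

Lemma srealN a : sreal k (- a) = - sreal k a.
Proof. by case: k => //=; rewrite rmorphN. Qed.

Lemma sreal1 : sreal k (1 : R) = 1.
Proof. by case: k => //=; rewrite rmorph1. Qed.

Lemma sreal0 : sreal k (0 : R) = 0.
Proof. by case: k => //=; rewrite rmorph0. Qed.

Lemma srealV a : sreal k a^-1 = (sreal k a)^-1.
Proof. by case: k => //=; rewrite fmorphV. Qed.

Lemma ler_sreal a b : (sreal k a <= sreal k b) = (a <= b).
Proof. by case: k => //=; rewrite lecR. Qed.

Lemma ltr_sreal a b : (sreal k a < sreal k b) = (a < b).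
Proof. by case: k => //=; rewrite ltcR. Qed.

Lemma normr_sreal a : `|sreal k a| = sreal k `|a|.
Proof. by case: k => //=; rewrite normc_def /= expr0n addr0 sqrtr_sqr. Qed.

Lemma srealK a : sRe (sreal k a) = a.
Proof. by case: k. Qed.

Lemma ge0_srealE c : 0 <= c -> c = sreal k (sRe c).
Proof.
case: k c => //= -[x y]; rewrite lecE /= => /andP[/eqP -> _] //.
Qed.

Lemma sReD c d : sRe (c + d) = sRe c + sRe d.
Proof. by case: k c d => //= c d; rewrite raddfD. Qed.

Lemma sReN c : sRe (- c) = - sRe c.
Proof. by case: k c => //= c; rewrite raddfN. Qed.

Lemma sRe_sconj c : sRe (sconj c) = sRe c.
Proof. by case: k c => //= -[]. Qed.

Lemma sRe_sreal_mul a c : sRe (sreal k a * c) = a * sRe c.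
Proof. by case: k c => //= -[x y] /=; rewrite mul0r subr0. Qed.

Lemma sconjK c : sconj (sconj c) = c.
Proof. by case: k c => //= c; exact: conjCK. Qed.

Lemma sRe_conj_mul_eq0 c : sRe (sconj c * c) = 0 -> c = 0.
Proof.
case: k c => /= [c /eqP|[x y]]; first by rewrite mulf_eq0 orbb => /eqP.
rewrite /= mulNr opprK => /eqP.
by rewrite -!expr2 paddr_eq0 ?sqr_ge0// !sqrf_eq0 => /andP[/eqP-> /eqP->].
Qed.

Lemma sRe_ge0_conj c : 0 <= sRe c -> sconj c = c -> 0 <= c.
Proof.
case: k c => //= -[x y] /= x0; rewrite lecE /= => -[] /eqP.
by rewrite eq_sym -subr_eq0 opprK -mulr2n mulrn_eq0/= => ->.
Qed.

Lemma sRe_ge0 c : 0 <= c -> 0 <= sRe c.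
Proof. by move=> c0; rewrite -ler_sreal -ge0_srealE// sreal0. Qed.

End Scalars.

(** * Elementary estimates *)

Lemma invn_small (R : realType) (e : R) : 0 < e ->
  exists N, forall n, (N <= n)%N -> n.+1%:R^-1 < e.
Proof.
move=> e0; exists (Num.truncn e^-1) => n Nn.
rewrite -(invrK e) ltf_pV2 ?posrE ?invr_gt0//.
by rewrite (lt_le_trans (truncnS_gt _))// ler_nat.
Qed.

Lemma finite_bound (R : realType) (u : nat -> R) N : exists c, forall n, (n < N)%N -> u n <= c.
Proof.
elim: N => [|N [c cP]]; first by exists 0.
exists (Num.max c (u N)) => n; rewrite ltnS leq_eqVlt le_max.
by move=> /predU1P[->|/cP ->//]; rewrite lexx orbT.
Qed.

Lemma geometric_le (R : realType) (a b C : R) : 0 <= C ->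
  (forall n : nat, a <= b + C / 2 ^+ n) -> a <= b.
Proof.
move=> C0 h; apply/ler_addgt0Pr => e e0.
have [n Cn] : exists n : nat, C / e <= n%:R.
  by exists (Num.truncn (C / e)).+1; rewrite ltW// truncnS_gt.
rewrite (le_trans (h n))// lerD2l ler_pdivrMr ?exprn_gt0// -ler_pdivrMl// mulrC.
rewrite (le_trans Cn)// -natrX ler_nat ltnW// ltn_expl//.
Qed.

Lemma geometric_small (R : realType) (C e : R) : 0 <= C -> 0 < e ->
  exists n : nat, C / 2 ^+ n < e.
Proof.
move=> C0 e0; apply: contrapT => hn; have : e <= 0.
  apply: (@geometric_le _ _ _ C) => // n.
  by rewrite add0r leNgt; apply/negP => c; apply: hn; exists n.
by rewrite leNgt e0.
Qed.

(** * The underlying real Hilbert space *)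

(** The real part of the inner product makes [H] a real Hilbert space with the
    same norm; a scalar crosses it as its conjugate ([rdot_conj]), which is all
    that is kept of a complex structure. *)
Definition rdot (R : realType) (k : scalars) (H : hilbertType R k) (x y : H) : R :=
  sRe '[x, y].

Section InnerProduct.
Context (R : realType) (k : scalars) (H : hilbertType R k).
Implicit Types (x y z : H) (t : R).

Lemma normE x : `|x| = sreal k (hnorm x).
Proof. by rewrite /hnorm -ge0_srealE. Qed.

Lemma inner_conj x y : '[x, y] = sconj '[y, x].
Proof. by rewrite [LHS](@hermitian_subproof _ _ _ _ inner) expr0 mul1r. Qed.

Lemma innerDl x y z : '[x + y, z] = '[x, z] + '[y, z].
Proof.
have := @zmod_morphisml_subproof _ _ _ _ _ _ (inner : {dot H for _}) z (x + y) y.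
by rewrite /= addrK => ->; rewrite subrK.
Qed.

Lemma innerZl (c : scalar_field R k) x y : '[c *: x, y] = c * '[x, y].
Proof. exact: (@linearl_subproof _ _ _ _ _ _ (inner : {dot H for _}) y c x). Qed.

Lemma innerZr (c : scalar_field R k) x y : '[x, c *: y] = sconj c * '[x, y].
Proof. exact: (@linearr_subproof _ _ _ _ _ _ (inner : {dot H for _}) x c y). Qed.

Lemma rdotC x y : rdot x y = rdot y x.
Proof. by rewrite /rdot inner_conj sRe_sconj. Qed.

Lemma rdotDl x y z : rdot (x + y) z = rdot x z + rdot y z.
Proof. by rewrite /rdot innerDl sReD. Qed.

Lemma rdotDr x y z : rdot x (y + z) = rdot x y + rdot x z.
Proof. by rewrite ![rdot x _]rdotC rdotDl. Qed.

Lemma rdotZl t x y : rdot (sreal k t *: x) y = t * rdot x y.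
Proof. by rewrite /rdot innerZl sRe_sreal_mul. Qed.

Lemma rdotZr t x y : rdot x (sreal k t *: y) = t * rdot x y.
Proof. by rewrite ![rdot x _]rdotC rdotZl. Qed.

Lemma rdotNl x y : rdot (- x) y = - rdot x y.
Proof. by rewrite -scaleN1r -(sreal1 R k) -srealN rdotZl mulN1r. Qed.

Lemma rdotNr x y : rdot x (- y) = - rdot x y.
Proof. by rewrite rdotC rdotNl rdotC. Qed.

Lemma rdotBl x y z : rdot (x - y) z = rdot x z - rdot y z.
Proof. by rewrite rdotDl rdotNl. Qed.

Lemma rdotBr x y z : rdot x (y - z) = rdot x y - rdot x z.
Proof. by rewrite rdotDr rdotNr. Qed.

Lemma rdot0l x : rdot 0 x = 0.
Proof. by rewrite -(subrr x) rdotBl subrr. Qed.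

Lemma rdot0r x : rdot x 0 = 0.
Proof. by rewrite rdotC rdot0l. Qed.

Lemma rdot_conj (c : scalar_field R k) x y : rdot (c *: x) y = rdot x (sconj c *: y).
Proof. by rewrite /rdot innerZl innerZr sconjK. Qed.

Lemma hnorm_ge0 x : 0 <= hnorm x.
Proof. exact: sRe_ge0. Qed.

Lemma rdotxx x : rdot x x = hnorm x ^+ 2.
Proof.
by rewrite /rdot -inner_normE normE expr2 sRe_sreal_mul srealK expr2.
Qed.

Lemma hnorm_gt0 x : hnorm x != 0 -> 0 < hnorm x.
Proof. by move=> x0; rewrite lt_neqAle eq_sym x0 hnorm_ge0. Qed.

Lemma hnormZ (c : scalar_field R k) x : hnorm (c *: x) = sRe `|c| * hnorm x.
Proof. by rewrite /hnorm normrZ (ge0_srealE (normr_ge0 c)) sRe_sreal_mul srealK. Qed.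

Lemma hnorm_sreal t x : hnorm (sreal k t *: x) = `|t| * hnorm x.
Proof. by rewrite hnormZ normr_sreal srealK. Qed.

Lemma hnorm0 : hnorm (0 : H) = 0.
Proof. by rewrite /hnorm normr0 -(sreal0 R k) srealK. Qed.

Lemma hnorm_eq0 x : hnorm x = 0 -> x = 0.
Proof. by move=> x0; apply: normr0_eq0; rewrite normE x0 sreal0. Qed.

Lemma hnormN x : hnorm (- x) = hnorm x.
Proof. by rewrite /hnorm normrN. Qed.

Lemma hnorm_subC x y : hnorm (x - y) = hnorm (y - x).
Proof. by rewrite -hnormN opprB. Qed.

Lemma hnormD x y : hnorm (x + y) <= hnorm x + hnorm y.
Proof. by rewrite -(ler_sreal k) srealD -!normE ler_normD. Qed.

Lemma hnormB x y : hnorm (x - y) <= hnorm x + hnorm y.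
Proof. by rewrite -(hnormN y) hnormD. Qed.

Lemma hnorm_tri y x z : hnorm (x - z) <= hnorm (x - y) + hnorm (y - z).
Proof. by have := hnormD (x - y) (y - z); rewrite addrA subrK. Qed.

Lemma hnorm_le_dist x y : hnorm x <= hnorm (x - y) + hnorm y.
Proof. by have := hnormD (x - y) y; rewrite subrK. Qed.

Lemma hnorm_sqrD x y :
  hnorm (x + y) ^+ 2 = hnorm x ^+ 2 + 2 * rdot x y + hnorm y ^+ 2.
Proof. by rewrite -!rdotxx rdotDl !rdotDr (rdotC y x); ring. Qed.

Lemma parallelogram x y :
  hnorm (x + y) ^+ 2 + hnorm (x - y) ^+ 2 = 2 * (hnorm x ^+ 2 + hnorm y ^+ 2).
Proof. by rewrite !hnorm_sqrD rdotNr hnormN; ring. Qed.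

Lemma rdot_le x y : rdot x y <= hnorm x * hnorm y.
Proof.
have [y0|y0] := eqVneq (hnorm y) 0.
  by rewrite (hnorm_eq0 y0) rdot0r hnorm0 mulr0.
have yp : 0 < hnorm y by exact: hnorm_gt0.
have [x0|x0] := eqVneq (hnorm x) 0.
  by rewrite (hnorm_eq0 x0) rdot0l hnorm0 mul0r.
have xp : 0 < hnorm x by exact: hnorm_gt0.
have := sqr_ge0 (hnorm (sreal k (hnorm y) *: x - sreal k (hnorm x) *: y)).
rewrite hnorm_sqrD rdotNr hnormN rdotZl rdotZr !hnorm_sreal.
rewrite !ger0_norm ?hnorm_ge0// => h.
rewrite -(ler_pM2l (mulr_gt0 xp yp)); nra.
Qed.

Lemma normr_rdot_le x y : `|rdot x y| <= hnorm x * hnorm y.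
Proof. by rewrite ler_norml rdot_le -(hnormN x) lerNl -rdotNl rdot_le. Qed.

Lemma rdot_inj x y : (forall z, rdot z x = rdot z y) -> x = y.
Proof.
move=> h; apply/subr0_eq/hnorm_eq0/eqP.
by rewrite -sqrf_eq0 -rdotxx rdotBr h subrr.
Qed.

Lemma hnorm_le_rdot x (c : R) : 0 <= c ->
  (forall z, rdot z x <= c * hnorm z) -> hnorm x <= c.
Proof.
move=> c0 /(_ x); rewrite rdotxx expr2.
have [->//|x0] := eqVneq (hnorm x) 0.
by rewrite ler_pM2r// lt_neqAle eq_sym x0 hnorm_ge0.
Qed.

Lemma hnormB_le_abs x y : `|hnorm x - hnorm y| <= hnorm (x - y).
Proof.
have := hnorm_le_dist x y; have := hnorm_le_dist y x; rewrite (hnorm_subC y x).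
by move=> ? ?; rewrite ler_norml; apply/andP; split; lra.
Qed.

Lemma cvg_hnormP (T : Type) (F : set_system T) (FF : Filter F) (f : T -> H) (l : H) :
  f @ F --> l <-> forall e : R, 0 < e -> \forall t \near F, hnorm (f t - l) < e.
Proof.
split=> [/cvgrPdist_lt h e e0|h].
  have /h : 0 < sreal k e by rewrite -(sreal0 R k) ltr_sreal.
  by apply: filterS => t; rewrite normE ltr_sreal hnorm_subC.
apply/cvgrPdist_lt => e e0; rewrite (ge0_srealE (ltW e0)).
have /h : 0 < sRe e by rewrite -(ltr_sreal k) sreal0 -ge0_srealE// ltW.
by apply: filterS => t; rewrite normE ltr_sreal hnorm_subC.
Qed.

Lemma hcauchy_cvg (u : nat -> H) :
  (forall e : R, 0 < e -> exists N, forall m n, (N <= m)%N -> (N <= n)%N ->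
     hnorm (u m - u n) < e) ->
  exists l : H, u @ \oo --> l.
Proof.
move=> h; suff uC : cauchy (u @ \oo) by apply/cvg_ex; exact: cauchy_cvg.
apply: cauchy_exP => e e0.
have [|N HN] := h (sRe e).
  by rewrite -(ltr_sreal k) sreal0 -ge0_srealE// ltW.
exists (u N); exists N => // n /= Nn.
by rewrite -ball_normE /= normE (ge0_srealE (ltW e0)) ltr_sreal HN.
Qed.

Lemma lim_in_closed_ball (u : nat -> H) (l x : H) (r : R) (N : nat) :
  u @ \oo --> l -> (forall n, (N <= n)%N -> hnorm (u n - x) <= r) ->
  hnorm (l - x) <= r.
Proof.
move=> /cvg_hnormP ul h; apply/ler_addgt0Pr => e e0.
have [M _ HM] := ul _ e0.
have := HM (maxn N M) (leq_maxr _ _); have := h (maxn N M) (leq_maxl _ _).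
move=> h1 /ltW; rewrite hnorm_subC => h2.
by rewrite (le_trans (hnorm_tri (u (maxn N M)) _ _))// addrC lerD.
Qed.

(** The constant is quantified after the limit: for the Picard iterates below it
    depends on the time horizon, whereas the limit must not. *)
Lemma geometric_cvg (u : nat -> H) :
  (exists2 C : R, 0 <= C & forall n, hnorm (u n.+1 - u n) <= C / 2 ^+ n) ->
  exists l, forall C : R, 0 <= C ->
    (forall n, hnorm (u n.+1 - u n) <= C / 2 ^+ n) ->
    forall n, hnorm (u n - l) <= 2 * C / 2 ^+ n.
Proof.
move=> [C C0 uC].
have p2 (n : nat) : 0 < 2 ^+ n :> R by rewrite exprn_gt0.
have tail (D : R) : 0 <= D -> (forall n, hnorm (u n.+1 - u n) <= D / 2 ^+ n) ->
    forall n m, (n <= m)%N -> hnorm (u m - u n) <= 2 * D / 2 ^+ n.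
  move=> D0 uD n m /subnKC <-; move: (m - n)%N => {}m.
  suff : hnorm (u (n + m)%N - u n) <= 2 * D / 2 ^+ n - 2 * D / 2 ^+ (n + m).
    by move/le_trans; apply; rewrite gerBl divr_ge0 ?mulr_ge0// ltW.
  elim: m => [|m IH]; first by rewrite addn0 !subrr hnorm0.
  rewrite addnS (le_trans (hnorm_tri (u (n + m)%N) _ _))//.
  rewrite (le_trans (lerD (uD _) IH))// exprS.
  have -> : 2 * D / (2 * 2 ^+ (n + m)) = D / 2 ^+ (n + m).
    by field; rewrite gt_eqF.
  have -> : 2 * D / 2 ^+ (n + m) = D / 2 ^+ (n + m) + D / 2 ^+ (n + m) by ring.
  lra.
have [e e0|l ul] := @hcauchy_cvg u.
  have [n nP] : exists n : nat, 2 * C / 2 ^+ n < e / 2.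
    by apply: geometric_small; [rewrite mulr_ge0|rewrite divr_gt0].
  exists n => i j ni nj; rewrite (le_lt_trans (hnorm_tri (u n) _ _))// (splitr e).
  by rewrite ltrD// ?[hnorm (u n - _)]hnorm_subC (le_lt_trans (tail _ C0 uC _ _ _) nP).
exists l => D D0 uD n; rewrite hnorm_subC.
exact: lim_in_closed_ball ul (tail D D0 uD n).
Qed.

End InnerProduct.

(* An identity between linear combinations of vectors is checked by pairing
   both sides with an arbitrary vector. *)
Ltac hilbert_ring :=
  apply: rdot_inj => ?;
  rewrite ?(scalerDr, scalerBr, scalerN) ?(rdotDr, rdotBr, rdotNr, rdotZr); ring.


(** * Bounded operators *)

Section BoundedOperators.
Context (R : realType) (k : scalars).

Lemma bop_le (H Y : hilbertType R k) (L : 'L(H, Y)) :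
  exists2 K : R, 0 < K & forall x, hnorm (L x) <= K * hnorm x.
Proof.
have /linear_boundedP/pinfty_ex_gt0 [K K0 LK] := bop_bounded L.
exists (sRe K); first by rewrite -(ltr_sreal k) sreal0 -ge0_srealE// ltW.
move=> x; have := LK x.
by rewrite !normE [in X in X -> _](ge0_srealE (ltW K0)) -srealM ler_sreal.
Qed.

Lemma mk_bop (H Y : hilbertType R k) (f : H -> Y) (K : R) :
  (forall c x y, f (c *: x + y) = c *: f x + f y) ->
  (forall x, hnorm (f x) <= K * hnorm x) ->
  exists L : 'L(H, Y), forall x, L x = f x.
Proof.
move=> flin fK.
pose fm := GRing.isLinear.Build _ _ _ _ f flin.
pose fL : {linear H -> Y} := HB.pack f fm.
have fB : bounded_near fL (nbhs (0 : H)).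
  apply/linear_boundedP; exists (sreal k K); split.
    by rewrite realE -(sreal0 R k) !ler_sreal le_total.
  move=> r Kr x; rewrite !normE (le_trans _ (ler_wpM2r _ (ltW Kr)))//.
    by rewrite -srealM ler_sreal fK.
  by rewrite -(sreal0 R k) ler_sreal hnorm_ge0.
by exists (BoundedOp fB).
Qed.

Lemma bop_cvg (H Y : hilbertType R k) (L : 'L(H, Y)) (T : Type)
    (F : set_system T) {FF : Filter F} (f : T -> H) (l : H) :
  f @ F --> l -> (fun t => L (f t)) @ F --> L l.
Proof.
move=> /cvg_hnormP h; apply/cvg_hnormP => e e0.
have [K K0 LK] := bop_le L.
have /h : 0 < e / K by rewrite divr_gt0.
apply: filterS => t; rewrite ltr_pdivlMr// mulrC => h1.
by rewrite -linearB (le_lt_trans (LK _)).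
Qed.

End BoundedOperators.

(** * The Riesz theorem and adjoints *)

Section Riesz.
Context (R : realType) (k : scalars).

(** Minimise [|P v|^2 - 2 f v].  By the parallelogram law the images [P (v n)] of
    a minimising sequence are Cauchy, and their limit [z] satisfies the Euler
    equation [<P v, z> = f v].  The range of [P] need not be closed; [z] lies in
    its closure, which is the content of the second clause and makes [z]
    unique, hence linear in [f]. *)
Lemma riesz_range (V : lmodType (scalar_field R k)) (H : hilbertType R k)
    (P : V -> H) (f : V -> R) (K : R) :
  (forall x y, P (x + y) = P x + P y) ->
  (forall t x, P (sreal k t *: x) = sreal k t *: P x) ->
  (forall x y, f (x + y) = f x + f y) ->
  (forall t x, f (sreal k t *: x) = t * f x) ->
  0 <= K -> (forall v, f v <= K * hnorm (P v)) ->
  exists z, [/\ forall v, rdot (P v) z = f v,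
    forall u, (forall v, rdot (P v) u = 0) -> rdot u z = 0 & hnorm z <= K].
Proof.
move=> PD PZ fD fZ K0 fK.
pose phi v := hnorm (P v) ^+ 2 - 2 * f v.
have phi_lb v : - K ^+ 2 <= phi v.
  have := fK v; have := sqr_ge0 (hnorm (P v) - K); rewrite /phi; nra.
have hI : has_inf (range phi).
  by split; [exists (phi 0), 0 | exists (- K ^+ 2) => _ [v _ <-]].
pose i := inf (range phi).
have phii v : i <= phi v by apply: ge_inf; [exact: (proj2 hI) | exists v].
have /choice[v vP] (n : nat) : exists x, phi x < i + n.+1%:R^-1.
  have [|_ [x _ <-] xP] := @inf_adherent _ (range phi) n.+1%:R^-1 _ hI.
    by rewrite invr_gt0.
  by exists x.
(* Parallelogram law, with [phi] bounded below by [i] at the midpoint. *)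
have mid a b : hnorm (P a - P b) ^+ 2 <= 2 * (phi a - i + (phi b - i)).
  have := phii (sreal k (2^-1) *: (a + b)).
  rewrite /phi PZ fZ fD PD hnorm_sreal ger0_norm ?invr_ge0// exprMn.
  have := parallelogram (P a) (P b); lra.
have small (e : R) : 0 < e -> exists N, forall n, (N <= n)%N -> phi (v n) - i < e.
  move=> /invn_small[N HN]; exists N => n /HN nN.
  by rewrite ltrBlDl (lt_trans (vP n))// ltrD2l.
have [e e0|z vz] := @hcauchy_cvg _ _ _ (fun n => P (v n)).
  have [|N HN] := small (e ^+ 2 / 4); first by rewrite divr_gt0 ?exprn_gt0.
  exists N => m n Nm Nn.
  rewrite -(@ltr_pXn2r _ 2) ?nnegrE ?hnorm_ge0 ?ltW//.
  have := mid (v m) (v n); have := HN _ Nm; have := HN _ Nn; lra.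
have close (e : R) : 0 < e -> exists n, phi (v n) - i < e /\ hnorm (P (v n) - z) < e.
  move=> e0; have [N HN] := small _ e0.
  have /cvg_hnormP/(_ _ e0) [M _ HM] := vz.
  exists (maxn N M); split; first by apply: HN; rewrite leq_maxl.
  by apply: HM; rewrite /= leq_maxr.
have zf w : rdot (P w) z = f w.
  set d := rdot (P w) z - f w.
  suff quad t : 0 <= t ^+ 2 * hnorm (P w) ^+ 2 + 2 * t * d.
    set q := hnorm (P w) ^+ 2 in quad.
    have q0 : 0 <= q by exact: sqr_ge0.
    (* A quadratic in [t] without constant term is non-negative only if its
       linear coefficient vanishes; evaluate near its minimum. *)
    have := quad (- d / (q + 1)).
    have -> : (- d / (q + 1)) ^+ 2 * q + 2 * (- d / (q + 1)) * d =
      - (d ^+ 2 * ((q + 2) / (q + 1) ^+ 2)) by field; lra.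
    rewrite oppr_ge0 => h.
    have : d ^+ 2 * ((q + 2) / (q + 1) ^+ 2) == 0.
      rewrite eq_le h mulr_ge0 ?sqr_ge0// divr_ge0 ?sqr_ge0//; lra.
    rewrite mulf_eq0 sqrf_eq0 => /orP[/eqP|]; first by rewrite /d; lra.
    rewrite mulf_eq0 invr_eq0 sqrf_eq0 => /orP[]/eqP; lra.
  apply/ler_addgt0Pr => e e0.
  pose c := 1 + 2 * `|t| * hnorm (P w).
  have c0 : 0 < c.
    have := mulr_ge0 (normr_ge0 t) (hnorm_ge0 (P w)); rewrite /c; lra.
  have [n [n1 n2]] := close (e / c) (divr_gt0 e0 c0).
  have := phii (v n + sreal k t *: w).
  have := normr_rdot_le (P w) (P (v n) - z).
  rewrite /phi PD PZ fD fZ hnorm_sqrD rdotZr hnorm_sreal exprMn real_normK ?num_real//.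
  rewrite rdotBr (rdotC (P (v n)) (P w)) => h1 h2.
  have h3 : 2 * t * (rdot (P w) (P (v n)) - rdot (P w) z) <=
      2 * `|t| * (hnorm (P w) * (e / c)).
    rewrite -!mulrA ler_pM2l//.
    rewrite (le_trans (ler_norm _))// normrM ler_wpM2l// (le_trans h1)//.
    by rewrite ler_wpM2l ?hnorm_ge0// ltW.
  have h4 : e / c * c = e by rewrite divfK// gt_eqF.
  move: n1; rewrite /phi /d /c in h4 *; nra.
exists z; split => //.
- move=> u uP; apply/eqP; rewrite -normr_le0; apply/ler_addgt0Pr => e e0.
  rewrite add0r.
  have c0 : 0 < 1 + hnorm u by rewrite ltr_pwDl// hnorm_ge0.
  have [n [_ n2]] := close (e / (1 + hnorm u)) (divr_gt0 e0 c0).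
  have := normr_rdot_le u (z - P (v n)).
  rewrite rdotBr (rdotC u (P _)) uP subr0 => /le_trans; apply.
  rewrite hnorm_subC.
  rewrite -[leRHS](divfK (lt0r_neq0 c0)) mulrC ler_pM ?hnorm_ge0 ?ltW//.
  by rewrite ltrDr.
- have [->//|z0] := eqVneq (hnorm z) 0.
  have zp : 0 < hnorm z by exact: hnorm_gt0.
  rewrite -(ler_pM2r zp); apply/ler_addgt0Pr => e e0.
  have c0 : 0 < K + hnorm z by rewrite ltr_wpDl.
  have [n [_ n2]] := close (e / (K + hnorm z)) (divr_gt0 e0 c0).
  have h1 := rdot_le (z - P (v n)) z.
  have := fK (v n); rewrite -zf => h2.
  have h3 := hnorm_le_dist (P (v n)) z.
  move: h1; rewrite rdotBl rdotxx hnorm_subC => h1.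
  move: n2; rewrite ltr_pdivlMr// => n2.
  have : K * hnorm (P (v n)) <= K * (hnorm (P (v n) - z) + hnorm z) by rewrite ler_wpM2l.
  nra.
Qed.

End Riesz.

Section RieszOperators.
Context (R : realType) (k : scalars).

Lemma rdot_conjr (H : hilbertType R k) (c : scalar_field R k) (x y : H) :
  rdot x (c *: y) = rdot (sconj c *: x) y.
Proof. by rewrite rdot_conj sconjK. Qed.

(** The Riesz vector of [b ^~ y] in the closure of the range of [P] is unique, so
    it depends linearly on [y]; the rule for moving a scalar from one argument
    of [b] to the other upgrades real linearity to linearity. *)
Lemma riesz_bop_range (V H Y : hilbertType R k) (P : {linear V -> H})
    (b : V -> Y -> R) (K : R) :
  (forall y u v, b (u + v) y = b u y + b v y) ->
  (forall u x y, b u (x + y) = b u x + b u y) ->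
  (forall t u y, b (sreal k t *: u) y = t * b u y) ->
  (forall (c : scalar_field R k) u y, b (c *: u) y = b u (sconj c *: y)) ->
  0 <= K -> (forall u y, b u y <= K * hnorm (P u) * hnorm y) ->
  exists L : 'L(Y, H), forall u y, rdot (P u) (L y) = b u y.
Proof.
move=> bDl bDr bZ bc K0 bK.
have /choice[g gP] (y : Y) : exists z : H, [/\ forall v, rdot (P v) z = b v y,
    forall u, (forall v, rdot (P v) u = 0) -> rdot u z = 0 &
    hnorm z <= K * hnorm y].
  apply: riesz_range => //.
  - by move=> u v; rewrite linearD.
  - by move=> t u; rewrite linearZ.
  - by rewrite mulr_ge0 ?hnorm_ge0.
  - by move=> v; rewrite mulrAC bK.
have gb y v : rdot (P v) (g y) = b v y by have [] := gP y.
have gorth y u : (forall v, rdot (P v) u = 0) -> rdot u (g y) = 0.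
  by have [_ + _] := gP y; apply.
have [] := @mk_bop _ _ Y H g K.
- move=> c x y; apply/subr0_eq; set d := _ - _.
  have dorth v : rdot (P v) d = 0.
    rewrite /d rdotBr rdotDr rdot_conjr -linearZ !gb bDr bc sconjK.
    by rewrite subrr.
  apply/hnorm_eq0/eqP; rewrite -sqrf_eq0 -rdotxx {2}/d rdotBr rdotDr.
  rewrite rdot_conjr !gorth ?addr0 ?subrr// => v.
  by rewrite -rdot_conj -linearZ dorth.
- by move=> y; have [] := gP y.
by move=> L LE; exists L => u y; rewrite LE gb.
Qed.

Lemma riesz_bop (H Y : hilbertType R k) (b : H -> Y -> R) (K : R) :
  (forall y u v, b (u + v) y = b u y + b v y) ->
  (forall u x y, b u (x + y) = b u x + b u y) ->
  (forall t u y, b (sreal k t *: u) y = t * b u y) ->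
  (forall (c : scalar_field R k) u y, b (c *: u) y = b u (sconj c *: y)) ->
  0 <= K -> (forall u y, b u y <= K * hnorm u * hnorm y) ->
  exists L : 'L(Y, H), forall u y, rdot u (L y) = b u y.
Proof. exact: (@riesz_bop_range H H Y idfun). Qed.

Lemma exists_adjoint (H Y : hilbertType R k) (L : 'L(H, Y)) :
  exists M : 'L(Y, H), forall x y, rdot x (M y) = rdot (L x) y.
Proof.
have [K K0 LK] := bop_le L.
apply: (@riesz_bop H Y (fun x y => rdot (L x) y) K).
- by move=> y u v; rewrite linearD rdotDl.
- by move=> u x y; rewrite rdotDr.
- by move=> t u y; rewrite linearZ rdotZl.
- by move=> c u y; rewrite linearZ rdot_conj.
- exact: ltW.
- move=> u y; rewrite (le_trans (rdot_le _ _))// ler_wpM2r ?hnorm_ge0//.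
Qed.

(** Real parts suffice: apply the hypothesis to [x] multiplied by the conjugate
    of the difference of the two sides. *)
Lemma inner_eq_rdot (H Y : hilbertType R k) (L : {linear H -> Y}) (y : Y) (z : H) :
  (forall x, rdot (L x) y = rdot x z) -> forall x, '[L x, y] = '[x, z].
Proof.
move=> h x; apply/subr0_eq/sRe_conj_mul_eq0.
rewrite mulrBr -!innerZl sReD sReN -linearZ.
by rewrite -[sRe _]/(rdot _ _) h subrr.
Qed.

Lemma adjointP (H Y : hilbertType R k) (L : 'L(H, Y)) x y :
  rdot x (adjoint L y) = rdot (L x) y.
Proof.
rewrite /adjoint; case: xgetP => [z _ /= zP|]; first by rewrite /rdot zP.
have [M MP] := exists_adjoint L.
by move=> /(_ (M y)) []; apply: inner_eq_rdot => u; rewrite MP.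
Qed.

Lemma adjoint_unique (H Y : hilbertType R k) (L : 'L(H, Y)) y z :
  (forall x, rdot (L x) y = rdot x z) -> adjoint L y = z.
Proof. by move=> h; apply: rdot_inj => x; rewrite adjointP h. Qed.

Lemma self_adjointP (H : hilbertType R k) (P : 'L(H, H)) :
  self_adjoint P <-> forall x y, rdot (P x) y = rdot x (P y).
Proof.
split=> [Psa x y|h y]; first by rewrite -adjointP Psa.
by apply: adjoint_unique => x.
Qed.

Lemma self_adjoint_nonneg (H : hilbertType R k) (P : 'L(H, H)) :
  self_adjoint P -> (forall x, 0 <= rdot (P x) x) -> nonneg_op P.
Proof.
move=> Psa P0 x; apply: sRe_ge0_conj; first exact: P0.
rewrite -inner_conj; apply/esym.
exact: (@inner_eq_rdot H H P x (P x) (fun y => proj1 (self_adjointP P) Psa y x)).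
Qed.

End RieszOperators.

(** * Uniform boundedness *)

Section UniformBoundedness.
Context (R : realType) (k : scalars) (H : hilbertType R k).

(** A Baire category argument with nested closed balls: were the conclusion
    false, every ball would contain a smaller one on which some [f i] exceeds
    any given number.  The weak subadditivity with a factor [2] admits quadratic
    forms besides seminorms, and lower semicontinuity replaces continuity. *)
Lemma uniform_boundedness (I : Type) (f : I -> H -> R) :
  (forall i x y, f i (x - y) <= 2 * (f i x + f i y)) ->
  (forall i c (u : nat -> H) x, u @ \oo --> x -> (forall n, f i (u n) <= c) ->
    f i x <= c) ->
  (forall x, exists c, forall i, f i x <= c) ->
  exists2 r : R, 0 < r & exists c, forall i u, hnorm u <= r -> f i u <= c.
Proof.
move=> fB flsc fpt; apply: contrapT => unb.
have far (r : R) c : 0 < r -> exists i u, hnorm u <= r /\ c < f i u.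
  move=> r0; apply: contrapT => h; apply: unb; exists r => //; exists c => i u ur.
  by rewrite leNgt; apply/negP => cf; apply: h; exists i, u.
have farx x (r c : R) : 0 < r -> exists i y, hnorm (y - x) <= r /\ c < f i y.
  move=> r0; have [i [u [ur cu]]] := far r (4 * c) r0.
  have [xc|xc] := ltP c (f i x).
    by exists i, x; rewrite subrr hnorm0 ltW.
  exists i, (x + u); rewrite addrC addKr; split => //.
  by have := fB i (x + u) x; rewrite addrC addKr addrC; lra.
have openf i x (c : R) : c < f i x ->
    exists2 r : R, 0 < r & forall y, hnorm (y - x) <= r -> c < f i y.
  move=> cx; apply: contrapT => h.
  have /choice[y yP] (n : nat) : exists y, hnorm (y - x) <= n.+1%:R^-1 /\ f i y <= c.
    apply: contrapT => h'; apply: h; exists n.+1%:R^-1; first by rewrite invr_gt0.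
    by move=> y yn; rewrite ltNge; apply/negP => yc; apply: h'; exists y.
  have : f i x <= c.
    apply: (flsc i c y); last by move=> n; have [] := yP n.
    apply/cvg_hnormP => e e0; have [N HN] := invn_small e0.
    by exists N => // n /= /HN; apply: le_lt_trans; have [] := yP n.
  by rewrite leNgt cx.
pose P (n : nat) (a b : H * R) := [/\ 0 < b.2, b.2 <= n.+1%:R^-1,
  forall y, hnorm (y - b.1) <= b.2 -> hnorm (y - a.1) <= a.2 &
  forall y, hnorm (y - b.1) <= b.2 -> exists i, n%:R < f i y].
(* The hypothesis on the radius lets the choice function be total. *)
have stepP (na : nat * (H * R)) : exists b, 0 < na.2.2 -> P na.1 na.2 b.
  case: na => n [x r] /=; have [r0|r0] := ltP 0 r; last by exists (x, r).
  have r2 : 0 < r / 2 by rewrite divr_gt0.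
  have [i [y [yx ny]]] := farx x (r / 2) n%:R r2.
  have [s s0 sP] := openf _ _ _ ny.
  exists (y, Num.min (Num.min s (r / 2)) n.+1%:R^-1) => _; split => /=.
  - by rewrite !lt_min s0 r2 invr_gt0 ltr0n.
  - by rewrite ge_min lexx orbT.
  - move=> z; rewrite !le_min -andbA => /and3P[_ zy _].
    by rewrite (le_trans (hnorm_tri y _ _))// (splitr r) lerD.
  - by move=> z; rewrite !le_min -andbA => /and3P[zy _ _]; exists i; apply: sP.
have [g gP] := choice stepP.
pose fix a n := if n is m.+1 then g (m, a m) else (0, 1) : H * R.
have a0 n : 0 < (a n).2.
  by elim: n => //= n IH; have [] := gP (n, a n) IH.
have aP n : P n (a n) (a n.+1) by exact: gP (n, a n) (a0 n).
have nested n m : (n <= m)%N ->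
    forall y, hnorm (y - (a m).1) <= (a m).2 -> hnorm (y - (a n).1) <= (a n).2.
  elim: m => [|m IH]; first by rewrite leqn0 => /eqP->.
  rewrite leq_eqVlt => /orP[/eqP->//|]; rewrite ltnS => nm y ym.
  by have [_ _ h _] := aP m; apply: IH => //; apply: h.
have inball n m : (n <= m)%N -> hnorm ((a m).1 - (a n).1) <= (a n).2.
  by move=> nm; apply: (nested n m nm); rewrite subrr hnorm0 ltW.
have [e e0|l al] := @hcauchy_cvg _ _ _ (fun n => (a n).1).
  have e2 : 0 < e / 2 by rewrite divr_gt0.
  have [N HN] := invn_small e2.
  exists N.+1 => m n Nm Nn.
  rewrite (le_lt_trans (hnorm_tri (a N.+1).1 _ _))// (splitr e).
  have aN : (a N.+1).2 < e / 2.
    by have [_ h _ _] := aP N; apply: le_lt_trans h _; apply: HN.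
  rewrite [in X in _ + X]hnorm_subC ltrD// (le_lt_trans (inball _ _ _))//.
have [c cP] := fpt l.
have [n cn] : exists n : nat, c <= n%:R.
  by exists (Num.truncn c).+1; rewrite ltW// truncnS_gt.
have [_ _ _ /(_ l) []] := aP n.
  by apply: (lim_in_closed_ball al) (inball _).
by move=> i; rewrite ltNge (le_trans (cP i)).
Qed.

Lemma banach_steinhaus (Y : hilbertType R k) (I : Type) (L : I -> 'L(H, Y)) :
  (forall x, exists c, forall i, hnorm (L i x) <= c) ->
  exists2 K : R, 0 < K & forall i x, hnorm (L i x) <= K * hnorm x.
Proof.
move=> Lpt.
have [] := @uniform_boundedness I (fun i x => hnorm (L i x)).
- move=> i x y; rewrite linearB (le_trans (hnormB _ _))//.
  by have := hnorm_ge0 (L i x); have := hnorm_ge0 (L i y); lra.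
- move=> i c u x ux hc; have h : (fun n => L i (u n)) @ \oo --> L i x by apply: bop_cvg.
  have := @lim_in_closed_ball _ _ _ _ _ 0 c 0 h; rewrite subr0; apply.
  by move=> n _; rewrite subr0.
- exact: Lpt.
move=> r r0 [c cP].
have c0 : 0 <= `|c| + 1 by rewrite addr_ge0.
exists ((`|c| + 1) / r); first by rewrite divr_gt0// ltr_wpDl.
move=> i x; have [x0|x0] := eqVneq (hnorm x) 0.
  by rewrite (hnorm_eq0 x0) linear0 !hnorm0 mulr0.
have xp : 0 < hnorm x by exact: hnorm_gt0.
have := cP i (sreal k (r / hnorm x) *: x).
have q0 : 0 <= r / hnorm x by rewrite divr_ge0 ?ltW.
rewrite linearZ !hnorm_sreal (ger0_norm q0) divfK// => /(_ (lexx _)).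
rewrite mulrAC ler_pdivrMr// => h.
rewrite mulrAC ler_pdivlMr// mulrC (le_trans h)// ler_wpM2r ?ltW//.
have := ler_norm c; lra.
Qed.

End UniformBoundedness.

(** * Integrals of continuous real functions *)

Section ScalarIntegral.
Context (R : realType).
Implicit Types (phi psi : R -> R) (a b c t : R).
Local Notation mu := (@lebesgue_measure R).

Definition rint a b phi : R := \int[mu]_(s in `[a, b]) phi s.

Lemma rint_integrable a b phi : continuous phi ->
  mu.-integrable `[a, b] (EFin \o phi).
Proof.
move=> cphi; apply: continuous_compact_integrable; first exact: segment_compact.
exact: continuous_subspaceT.
Qed.

Lemma rint_ext a b phi psi : (forall s, a <= s <= b -> phi s = psi s) ->
  rint a b phi = rint a b psi.
Proof. by move=> h; apply: eq_Rintegral => s; rewrite inE /= in_itv /= => /h. Qed.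

Lemma rintD a b phi psi : continuous phi -> continuous psi ->
  rint a b (fun s => phi s + psi s) = rint a b phi + rint a b psi.
Proof. by move=> cphi cpsi; apply: RintegralD => //; exact: rint_integrable. Qed.

Lemma rintZ a b c phi : continuous phi ->
  rint a b (fun s => c * phi s) = c * rint a b phi.
Proof. by move=> cphi; apply: RintegralZl => //; exact: rint_integrable. Qed.

Lemma rint_le a b phi psi : continuous phi -> continuous psi ->
  (forall s, a <= s <= b -> phi s <= psi s) -> rint a b phi <= rint a b psi.
Proof.
move=> cphi cpsi h.
exact: (le_Rintegral _ (rint_integrable a b cphi) (rint_integrable a b cpsi)).
Qed.

Lemma rint_cst a b c : a <= b -> rint a b (fun=> c) = c * (b - a).
Proof.
move=> ab; rewrite /rint Rintegral_cst//.
rewrite /= lebesgue_measure_itv.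
rewrite /= lte_fin; case: ltP => //= ba.
have -> : a = b by apply/le_anti; rewrite ab ba.
by rewrite subrr.
Qed.

Lemma rint_bound a b c phi : continuous phi -> a <= b ->
  (forall s, a <= s <= b -> phi s <= c) -> rint a b phi <= c * (b - a).
Proof.
by move=> cphi ab h; rewrite -rint_cst// rint_le// => s; exact: cst_continuous.
Qed.

Lemma rint_ge0 a b phi : (forall s, a <= s <= b -> 0 <= phi s) -> 0 <= rint a b phi.
Proof. by move=> h; apply: Rintegral_ge0 => s; rewrite /= in_itv /=; exact: h. Qed.

Lemma rint_chasles b a c phi : continuous phi -> a <= b -> b <= c ->
  rint a c phi = rint a b phi + rint b c phi.
Proof.
move=> cphi ab bc; rewrite /rint.
have := @Rintegral_itvB _ phi (BLeft a) (BRight c) b (@rint_integrable a c phi cphi).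
rewrite !bnd_simp => /(_ ab bc) h.
rewrite -[X in _ = _ + X]Rintegral_itv_obnd_cbnd -?h; first by rewrite addrCA subrr addr0.
apply: (@integrableS _ _ _ mu `[b, c]) => //; last exact: rint_integrable.
exact: subset_itv_oc_cc.
Qed.

Lemma continuous_bound (phi : R -> R) (N : R) : continuous phi ->
  exists2 c : R, 0 <= c & forall s : R, 0 <= s <= N -> phi s <= c.
Proof.
move=> cphi; have [N0|N0] := leP 0 N; last first.
  by exists 0 => // s /andP[s0 /(le_trans s0)]; rewrite leNgt N0.
have [c _ cP] := EVT_max N0 (continuous_subspaceT (A := `[0, N]) cphi).
exists (Num.max 0 (phi c)) => [|s sN]; first by rewrite le_max lexx.
by rewrite le_max cP ?orbT// in_itv.
Qed.

Lemma lebesgue_measure_shift t (A : set (measurableTypeR R)) : measurable A ->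
  pushforward mu ((fun s => s + t) : _ -> measurableTypeR R) A = mu A.
Proof.
move=> mA; apply/esym/lebesgue_measure_unique => //=.
  exact: measurable_funD.
move=> mf _ [[a b]] _ <-.
rewrite /pushforward.
rewrite (_ : _ @^-1` _ = `]a - t, b - t]%classic); last first.
  by apply/seteqP; split=> s /=; rewrite !in_itv/= ltrBlDr lerBrDr.
rewrite !lebesgue_measure_itv/= !lte_fin ltrD2r; case: ifP => // _.
by rewrite -!EFinB; congr (_%:E); lra.
Qed.

Lemma ge0_integral_shift t (D : set (measurableTypeR R))
    (f : measurableTypeR R -> \bar R) :
  measurable D -> measurable_fun D f -> (forall s, D s -> (0 <= f s)%E) ->
  (\int[mu]_(s in D) f s =
   \int[mu]_(s in (fun s : R => (s + t)%R) @^-1` D) f (s + t)%R)%E.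
Proof.
move=> mD mf f0.
pose g : measurableTypeR R -> measurableTypeR R := fun s => s + t.
have mg : measurable_fun setT g by exact: measurable_funD.
have := @ge0_integral_pushforward _ _ _ _ _ _ mg mu _ f mD mf.
move=> <-; last by move=> s; rewrite inE; exact: f0.
by apply: eq_measure_integral => //= A mA _; rewrite lebesgue_measure_shift.
Qed.

Lemma rint_shift t a b phi : continuous phi ->
  rint (a + t) (b + t) phi = rint a b (fun s => phi (s + t)).
Proof.
move=> cphi.
pose g : measurableTypeR R -> measurableTypeR R := fun s => s + t.
have mg : measurable_fun setT g by exact: measurable_funD.
have pre : `[a, b]%classic = g @^-1` `[a + t, b + t]%classic.
  by apply/seteqP; split=> s /=; rewrite !in_itv/= !lerD2r.
rewrite /rint /Rintegral pre.
have <- := @integral_pushforward _ _ _ _ _ _ mg mu `[a + t, b + t] (EFin \o phi).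
- by congr fine; apply: eq_measure_integral => //= A mA _;
  rewrite lebesgue_measure_shift.
- by apply/measurable_EFinP; exact: continuous_measurable_fun.
- rewrite -pre; apply: (@rint_integrable a b (fun s => phi (s + t))).
  move=> s; apply: (@continuous_comp _ _ _ (fun s => s + t) phi).
    by apply: cvgD => //; exact: cvg_cst.
  exact: cphi.
- exact: measurable_itv.
Qed.

Lemma rint_expR (lam t : R) : 0 < lam -> 0 <= t ->
  rint 0 t (fun s => expR (lam * s)) <= expR (lam * t) / lam.
Proof.
move=> lam0; rewrite le_eqVlt => /predU1P[<-|t0].
  rewrite /rint set_itv1 Rintegral_set1 divr_ge0 ?expR_ge0 ?ltW//.
have d (s : R) : is_derive s 1 (fun s : R => expR (lam * s) / lam) (expR (lam * s)).
  apply: trigger_derive.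
  rewrite scaler0 add0r.
  by rewrite -[LHS]/(lam^-1 * (expR (lam * s) * (lam * 1))) mulr1 mulrCA mulVf ?mulr1// gt_eqF.
rewrite /rint /Rintegral (@continuous_FTC2 _ _ (fun s => expR (lam * s) / lam))//=.
- by rewrite gerBl divr_ge0 ?expR_ge0 ?ltW.
- apply: continuous_subspaceT => s; apply: (@continuous_comp _ _ _ (fun s => lam * s) expR).
    by apply: cvgM => //; exact: cvg_cst.
  exact: continuous_expR.
- have cF s : {for s, continuous (fun s => expR (lam * s) / lam)}.
    by apply/differentiable_continuous/derivable1_diffP; have [] := d s.
  split.
  + by move=> s _; have [] := d s.
  + exact: cvg_at_right_filter (cF 0).
  + exact: cvg_at_left_filter (cF t).
- by move=> s _; rewrite derive1E; have [_ ] := d s.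
Qed.

Lemma rint_param_continuous (f : R -> R -> R) a b (M : R) (t0 : R) :
  (forall t, continuous (f t)) -> (forall s, continuous (f ^~ s)) ->
  (forall t s, `|t - t0| < 1 -> a <= s <= b -> `|f t s| <= M) ->
  {for t0, continuous (fun t => rint a b (f t))}.
Proof.
move=> ct cs fM.
have := @continuity_under_integral R _ _ mu f `[a, b] _ (t0 - 1) (t0 + 1) _ _ (fun=> M).
apply => //.
- by move=> x _; exact: rint_integrable.
- by apply: aeW => s _ x _; exact: cs.
- exact: (@rint_integrable a b (fun=> M) (fun s => @cst_continuous _ _ M s)).
- move=> x /= xI; apply: aeW => s /=; rewrite in_itv/=; apply: fM.
  by move: xI; rewrite in_itv/= ltr_norml => /andP[? ?]; apply/andP; split; lra.
- by rewrite inE /= in_itv/=; apply/andP; split; lra.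
Qed.

End ScalarIntegral.

(** * Integrals of continuous vector functions *)

Section VectorIntegral.
Context (R : realType) (k : scalars).

Lemma cvg_rdot (H : hilbertType R k) (T : Type) (F : set_system T) {FF : Filter F}
    (f g : T -> H) (l m : H) :
  f @ F --> l -> g @ F --> m -> rdot (f t) (g t) @[t --> F] --> rdot l m.
Proof.
move=> /cvg_hnormP fl /cvg_hnormP gm.
suff key (e : R) : 0 < e -> \forall t \near F, `|rdot l m - rdot (f t) (g t)| < e.
  by apply/cvgrPdist_lt => e /key.
move=> e0; pose c := hnorm l + hnorm m + 1.
have c0 : 0 < c by rewrite ltr_pwDr// addr_ge0 ?hnorm_ge0.
pose d := Num.min 1 (e / (c + c)).
have d0 : 0 < d by rewrite lt_min ltr01; apply: divr_gt0 => //; apply: addr_gt0.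
near=> t.
have h1 : hnorm (f t - l) < d by near: t; exact: fl.
have h2 : hnorm (g t - m) < d by near: t; exact: gm.
have dc : d * (c + c) <= e by rewrite -(ler_pdivlMr _ _ (addr_gt0 c0 c0)) ge_min lexx orbT.
have d1 : d <= 1 by rewrite ge_min lexx.
have -> : rdot l m - rdot (f t) (g t) =
    - (rdot (f t - l) (g t - m) + rdot (f t - l) m + rdot l (g t - m)).
  by rewrite !rdotBl !rdotBr; ring.
rewrite normrN.
have n0 := hnorm_ge0 (f t - l); have n1 := hnorm_ge0 (g t - m).
have n2 := hnorm_ge0 l; have n3 := hnorm_ge0 m.
have := normr_rdot_le (f t - l) (g t - m); have := normr_rdot_le (f t - l) m.
have := normr_rdot_le l (g t - m).
have := ler_normD (rdot (f t - l) (g t - m) + rdot (f t - l) m) (rdot l (g t - m)).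
have := ler_normD (rdot (f t - l) (g t - m)) (rdot (f t - l) m).
have h3 : hnorm (f t - l) * hnorm (g t - m) <= d by nra.
have h4 : hnorm (f t - l) * hnorm m <= d * hnorm m by rewrite ler_wpM2r// ltW.
have h5 : hnorm l * hnorm (g t - m) <= d * hnorm l by rewrite mulrC ler_wpM2r// ltW.
have h6 : d * (hnorm l + hnorm m + 1) < e by move: dc; rewrite /c; nra.
nra.
Unshelve. all: by end_near. Qed.

Lemma cvg_hnorm (H : hilbertType R k) (T : Type) (F : set_system T) {FF : Filter F}
    (f : T -> H) (l : H) : f @ F --> l -> hnorm (f t) @[t --> F] --> hnorm l.
Proof.
move=> /cvg_hnormP fl; apply/cvgrPdist_lt => e /fl; apply: filterS => t h.
by rewrite (le_lt_trans (hnormB_le_abs _ _))// hnorm_subC.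
Qed.

Lemma continuous_rdot (H : hilbertType R k) (z : H) (f : R -> H) :
  continuous f -> continuous (fun s => rdot z (f s)).
Proof. by move=> cf s; apply: cvg_rdot (cf s); exact: cvg_cst. Qed.

Lemma continuous_hnorm (H : hilbertType R k) (f : R -> H) :
  continuous f -> continuous (fun s => hnorm (f s)).
Proof. by move=> cf s; apply: cvg_hnorm (cf s). Qed.

Lemma continuous_sqr_hnorm (H : hilbertType R k) (f : R -> H) : continuous f ->
  continuous (fun t => hnorm (f t) ^+ 2).
Proof.
move=> cf t; under eq_fun do rewrite expr2.
by apply: cvgM; exact: continuous_hnorm.
Qed.

Lemma continuous_bop (H Y : hilbertType R k) (L : 'L(H, Y)) (f : R -> H) :
  continuous f -> continuous (fun s => L (f s)).
Proof. by move=> cf s; apply: bop_cvg (cf s). Qed.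

Lemma continuous_shiftr (H : hilbertType R k) (f : R -> H) (t : R) :
  continuous f -> continuous (fun s => f (s + t)).
Proof.
move=> cf s; apply: (@continuous_comp _ _ _ (fun s => s + t) f); last exact: cf.
by apply: cvgD => //; exact: cvg_cst.
Qed.

(** The Pettis integral: the vector whose inner products are the integrals of the
    inner products.  It exists for continuous [f] by the Riesz theorem. *)
Definition wint (H : hilbertType R k) (a b : R) (f : R -> H) : H :=
  xget 0 [set w | forall z, rdot z w = rint a b (fun s => rdot z (f s))].

Section Fixed.
Context (H : hilbertType R k).
Implicit Types (f g : R -> H) (a b c : R).

Lemma wintP a b f : continuous f ->
  forall z, rdot z (wint a b f) = rint a b (fun s => rdot z (f s)).
Proof.
move=> cf; rewrite /wint; case: xgetP => [w _ //|].
have cz z := continuous_rdot (z := z) cf.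
have [||||||z [zP _ _] /(_ z)[]//] := @riesz_range R k H H idfun
  (fun z => rint a b (fun s => rdot z (f s))) (rint a b (fun s => hnorm (f s))) => //.
- move=> x y; rewrite -rintD//; apply: rint_ext => s _; exact: rdotDl.
- move=> t x; rewrite -rintZ//; apply: rint_ext => s _; exact: rdotZl.
- by apply: rint_ge0 => s _; exact: hnorm_ge0.
- move=> v; rewrite mulrC -rintZ; last exact: continuous_hnorm.
  apply: rint_le => // [|s _]; last exact: rdot_le.
  move=> s; apply: cvgM; first exact: cvg_cst.
  exact: continuous_hnorm.
Qed.

Lemma wint_unique a b f w : continuous f ->
  (forall z, rdot z w = rint a b (fun s => rdot z (f s))) -> wint a b f = w.
Proof. by move=> cf h; apply: rdot_inj => z; rewrite wintP// h. Qed.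

Lemma wint_ext a b f g : (forall s, a <= s <= b -> f s = g s) ->
  wint a b f = wint a b g.
Proof.
move=> fg; congr xget; apply/seteqP; split=> w /= h z; rewrite h;
  by apply: rint_ext => s /fg ->.
Qed.

Lemma wint_le a b f (phi : R -> R) : continuous f -> continuous phi ->
  (forall s, a <= s <= b -> hnorm (f s) <= phi s) ->
  hnorm (wint a b f) <= rint a b phi.
Proof.
move=> cf cphi h; apply: hnorm_le_rdot => [|z].
  by apply: rint_ge0 => s /h; apply: le_trans; exact: hnorm_ge0.
rewrite wintP// mulrC -rintZ//; apply: rint_le.
- exact: continuous_rdot.
- by move=> s; apply: cvgM; [exact: cvg_cst|exact: cphi].
- by move=> s /h fs; rewrite (le_trans (rdot_le _ _))// ler_wpM2l ?hnorm_ge0.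
Qed.

Lemma wint_bound a b c f : continuous f -> a <= b ->
  (forall s, a <= s <= b -> hnorm (f s) <= c) -> hnorm (wint a b f) <= c * (b - a).
Proof.
move=> cf ab h; rewrite -rint_cst//; apply: wint_le => // s.
exact: cst_continuous.
Qed.

Lemma wintD a b f g : continuous f -> continuous g ->
  wint a b (fun s => f s + g s) = wint a b f + wint a b g.
Proof.
move=> cf cg; apply: wint_unique => [s|z].
  by apply: cvgD; [exact: cf|exact: cg].
rewrite rdotDr !wintP// -rintD; [|exact: continuous_rdot..].
by apply: rint_ext => s _; rewrite rdotDr.
Qed.

Lemma wint_cst a b (x : H) : a <= b -> wint a b (fun=> x) = sreal k (b - a) *: x.
Proof.
move=> ab; apply: wint_unique => [s|z]; first exact: cst_continuous.
by rewrite rint_cst// rdotZr mulrC.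
Qed.

Lemma wint_chasles b a c f : continuous f -> a <= b -> b <= c ->
  wint a c f = wint a b f + wint b c f.
Proof.
move=> cf ab bc; apply: wint_unique => // z.
by rewrite rdotDr !wintP// -rint_chasles//; exact: continuous_rdot.
Qed.

Lemma wint_shift t a b f : continuous f ->
  wint (a + t) (b + t) f = wint a b (fun s => f (s + t)).
Proof.
move=> cf; apply/esym/wint_unique => [|z]; first exact: continuous_shiftr.
rewrite wintP//.
by rewrite (rint_shift t a b (phi := fun s => rdot z (f s)))//; exact: continuous_rdot.
Qed.

End Fixed.

Lemma wint_bop (H Y : hilbertType R k) (L : 'L(H, Y)) a b (f : R -> H) :
  continuous f -> L (wint a b f) = wint a b (fun s => L (f s)).
Proof.
move=> cf; apply/esym/wint_unique => [|z]; first exact: continuous_bop.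
rewrite rdotC -adjointP rdotC wintP//.
by apply: rint_ext => s _; rewrite rdotC adjointP rdotC.
Qed.

Lemma wintZ (H : hilbertType R k) a b (c : scalar_field R k) (f : R -> H) :
  continuous f -> wint a b (fun s => c *: f s) = c *: wint a b f.
Proof.
move=> cf; apply: wint_unique => [s|z]; first exact: cvgZr (cf s).
rewrite rdot_conjr wintP//; by apply: rint_ext => s _; rewrite -rdot_conjr.
Qed.

Lemma wintN (H : hilbertType R k) a b (f : R -> H) :
  continuous f -> wint a b (fun s => - f s) = - wint a b f.
Proof.
move=> cf; apply: wint_unique => [s|z]; first exact: cvgN (cf s).
rewrite rdotNr wintP// -mulN1r -rintZ; last exact: continuous_rdot.
by apply: rint_ext => s _; rewrite rdotNr mulN1r.
Qed.

End VectorIntegral.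

(** * Strongly continuous semigroups *)

Section Semigroups.
Context (R : realType) (k : scalars) (H : hilbertType R k).
Context (T : R -> 'L(H, H)) (HT : C0_semigroup T).

Lemma sg0 x : T 0 x = x.
Proof. by case: HT. Qed.

Lemma sgD s t x : 0 <= s -> 0 <= t -> T (s + t) x = T s (T t x).
Proof. by case: HT => _ h _ s0 t0; apply: h. Qed.

Lemma sg_near0 x (e : R) : 0 < e ->
  exists2 d : R, 0 < d & forall t : R, 0 <= t < d -> hnorm (T t x - x) < e.
Proof.
case: HT => T0 _ /(_ x) /cvg_hnormP h e0.
have [d /= d0 hd] := h _ e0.
exists d => // t /andP[t0 td].
have [->|tn0] := eqVneq t 0; first by rewrite T0 subrr hnorm0.
have tp : 0 < t by rewrite lt_neqAle eq_sym tn0.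
by apply: hd => //=; rewrite sub0r normrN gtr0_norm.
Qed.

(** Otherwise there are times [t n] tending to [0] along which the norms of
    [T (t n)] are unbounded, although [T (t n) x] converges for every [x]. *)
Lemma sg_bounded_near0 : exists2 d : R, 0 < d &
  exists2 M : R, 1 <= M & forall (t : R) x, 0 <= t <= d -> hnorm (T t x) <= M * hnorm x.
Proof.
apply: contrapT => unb.
have /choice[t tP] (n : nat) : exists t : R, 0 <= t <= n.+1%:R^-1 /\
    exists x, n.+1%:R * hnorm x < hnorm (T t x).
  apply: contrapT => h; apply: unb; exists n.+1%:R^-1; first by rewrite invr_gt0.
  exists n.+1%:R => [|t x tn]; first by rewrite ler1n.
  by rewrite leNgt; apply/negP => c; apply: h; exists t; split => //; exists x.
have [x|K K0 KP] := @banach_steinhaus _ _ H H nat (fun n => T (t n)).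
  have [d d0 dP] := sg_near0 x ltr01.
  have [N HN] := invn_small d0.
  have [c cP] := finite_bound (fun n => hnorm (T (t n) x)) N.
  exists (Num.max c (1 + hnorm x)) => n; rewrite le_max.
  have [nN|Nn] := ltnP n N; first by rewrite cP.
  apply/orP; right; rewrite (le_trans (hnorm_le_dist _ x))// lerD2r ltW//.
  have [/andP[t0 tn] _] := tP n.
  by apply: dP; rewrite t0 (le_lt_trans tn)// HN.
have [n Kn] : exists n : nat, K <= n.+1%:R.
  by exists (Num.truncn K); rewrite ltW// truncnS_gt.
have [_ [x]] := tP n; apply/negP; rewrite -leNgt.
by rewrite (le_trans (KP _ _))// ler_wpM2r ?hnorm_ge0.
Qed.

Lemma sg_bounded (N : R) : exists2 M : R, 1 <= M &
  forall (t : R) x, 0 <= t <= N -> hnorm (T t x) <= M * hnorm x.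
Proof.
have [d d0 [M M1 MP]] := sg_bounded_near0.
have powers (n : nat) (t : R) x : 0 <= t <= n%:R * d -> hnorm (T t x) <= M ^+ n * hnorm x.
  elim: n t x => [|n IH] t x /andP[t0 td].
    have -> : t = 0 by apply/le_anti; rewrite t0 andbT (le_trans td)// mul0r.
    by rewrite sg0 expr0 mul1r.
  have [tsmall|tbig] := leP t d.
    rewrite (le_trans (MP _ _ _)) ?t0// ler_wpM2r ?hnorm_ge0//.
    by rewrite exprS ler_peMr ?exprn_ege1// (le_trans ler01).
  have -> : t = d + (t - d) by ring.
  have td0 : 0 <= t - d by rewrite subr_ge0 ltW.
  rewrite sgD ?(ltW d0)// (le_trans (MP _ _ _)) ?lexx ?(ltW d0)// exprS -mulrA.
  rewrite ler_wpM2l ?(le_trans ler01)// IH// td0 /=.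
  by rewrite lerBlDr (le_trans td)// -natr1 mulrDl mul1r.
have [n Nn] : exists n : nat, N <= n%:R * d.
  exists (Num.truncn (N / d)).+1.
  by rewrite -ler_pdivrMr// ltW// truncnS_gt.
exists (M ^+ n); first by rewrite exprn_ege1.
by move=> t x /andP[t0 tN]; apply: powers; rewrite t0 (le_trans tN).
Qed.

(** Functions on the half-line are extended evenly, since integrals are taken of
    functions continuous on the whole line. *)
Lemma continuous_abs (g : R -> H) :
  (forall t0 e : R, 0 <= t0 -> 0 < e -> exists2 d : R, 0 < d &
     forall t : R, 0 <= t -> `|t - t0| < d -> hnorm (g t - g t0) < e) ->
  continuous (fun t : R => g `|t|).
Proof.
move=> h t0; apply/cvg_hnormP => e e0.
have [d d0 dP] := h `|t0| e (normr_ge0 _) e0.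
exists d => //= t /= td; apply: dP => //.
by rewrite (le_lt_trans (ler_dist_dist _ _))// distrC.
Qed.

Lemma sg_continuous x : continuous (fun t : R => T `|t| x).
Proof.
apply: (@continuous_abs (fun t => T t x)) => t0 e t00 e0.
have [M M1 MP] := sg_bounded (t0 + 1).
have M0 : 0 < M by rewrite (lt_le_trans ltr01).
have [d d0 dP] := sg_near0 x (divr_gt0 e0 M0).
exists (Num.min 1 d); first by rewrite lt_min ltr01.
move=> t tp; rewrite lt_min => /andP[t1 td].
have step (a b : R) : 0 <= a -> a <= b -> a <= t0 + 1 -> b - a < d ->
    hnorm (T b x - T a x) < e.
  move=> a0 ab at0 bad.
  have -> : b = a + (b - a) by ring.
  rewrite sgD ?subr_ge0// -linearB (le_lt_trans (MP _ _ _)) ?a0//.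
  by rewrite mulrC -ltr_pdivlMr// dP// subr_ge0 ab.
have [tt0|t0t] := leP t0 t.
  by apply: step => //; [rewrite lerDl|rewrite -(ger0_norm (_ : 0 <= t - t0)) ?subr_ge0].
rewrite hnorm_subC; apply: step => //; [exact: ltW|by rewrite (le_trans (ltW t0t))// lerDl|].
by rewrite -(ger0_norm (_ : 0 <= t0 - t)) ?subr_ge0 ?ltW// distrC.
Qed.

Lemma sg_app_continuous (h : R -> R) (g : R -> H) : continuous h -> continuous g ->
  continuous (fun s => T `|h s| (g s)).
Proof.
move=> ch cg s0; apply/cvg_hnormP => e e0.
have [M M1 MP] := sg_bounded (`|h s0| + 1).
have M0 : 0 < M by rewrite (lt_le_trans ltr01).
have e2 : 0 < e / 2 by rewrite divr_gt0.
have c1 : (fun s => T `|h s| (g s0)) @ s0 --> T `|h s0| (g s0).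
  apply: (@continuous_comp _ _ _ h (fun t : R => T `|t| (g s0))); first exact: ch.
  exact: sg_continuous.
near=> s.
have h1 : hnorm (T `|h s| (g s0) - T `|h s0| (g s0)) < e / 2.
  by near: s; move/cvg_hnormP : c1; apply.
have h2 : hnorm (g s - g s0) < e / 2 / M.
  by near: s; move/cvg_hnormP : (cg s0); apply; exact: divr_gt0.
have h3 : `|h s0 - h s| < 1.
  by near: s; move/cvgrPdist_lt : (ch s0); apply; exact: ltr01.
have h4 : `|h s| <= `|h s0| + 1.
  have := ler_normB (h s0) (h s0 - h s); rewrite opprB addrC subrK.
  by move/le_trans; apply; rewrite lerD2l ltW.
rewrite (le_lt_trans (hnorm_tri (T `|h s| (g s0)) _ _))// (splitr e) ltrD//.
rewrite -linearB (le_lt_trans (MP _ _ _)) ?normr_ge0//.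
by rewrite mulrC -ltr_pdivlMr.
Unshelve. all: by end_near. Qed.

(** * Bounded perturbations of generators *)

Section Duhamel.
Context (B : 'L(H, H)).

(** The absolute value only serves continuity in [s] on the whole line; within the
    range of integration [t - s] is non-negative. *)
Definition duhamel (g : R -> H) (t : R) : H :=
  wint 0 t (fun s => T `|t - s| (B (g s))).

Lemma duhamel_integrand (g : R -> H) (t : R) : continuous g ->
  continuous (fun s : R => T `|t - s| (B (g s))).
Proof.
move=> cg; apply: sg_app_continuous; last exact: continuous_bop.
by move=> s; apply: cvgB => //; exact: cvg_cst.
Qed.

Lemma duhamel0 g : continuous g -> duhamel g 0 = 0.
Proof.
move=> cg; apply: wint_unique => [|z]; first exact: duhamel_integrand.
by rewrite rdot0r /rint set_itv1 Rintegral_set1.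
Qed.

Lemma duhamel_linear (c : scalar_field R k) (f g : R -> H) t :
  continuous f -> continuous g ->
  duhamel (fun s => c *: f s + g s) t = c *: duhamel f t + duhamel g t.
Proof.
move=> cf cg; rewrite /duhamel -wintZ; last exact: duhamel_integrand.
rewrite -wintD; [|by move=> s; apply: cvgZr; exact: duhamel_integrand|exact: duhamel_integrand].
by apply: wint_ext => s _; rewrite !linearP.
Qed.

(** The integrand is compared with the one at [t1] on the fixed interval [[0, N]],
    where dominated convergence applies; the remaining interval between [t1]
    and [t] is short and the integrand is bounded there. *)
Lemma duhamel_continuous (g : R -> H) : continuous g ->
  continuous (fun t : R => duhamel g `|t|).
Proof.
move=> cg; apply: continuous_abs => t1 e t10 e0.
pose N := t1 + 1; have N0 : 0 <= N by rewrite addr_ge0.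
have [M M1 MP] := sg_bounded N.
have M0 : 0 < M by rewrite (lt_le_trans ltr01).
have [c c0 cP] := continuous_bound N (continuous_hnorm (continuous_bop (L := B) cg)).
pose h (t s : R) := T `|t - s| (B (g s)).
have ch t : continuous (h t) by exact: duhamel_integrand.
pose f t s := hnorm (h t s - h t1 s).
have hle (t s : R) : 0 <= t <= N -> 0 <= s <= N -> hnorm (h t s) <= M * c.
  move=> tN sN; rewrite (le_trans (MP _ _ _))//; last by rewrite ler_pM2l// cP.
  rewrite normr_ge0 /= ler_norml; move: tN sN => /andP[? ?] /andP[? ?].
  by apply/andP; split; lra.
have fint : {for t1, continuous (fun t : R => rint 0 N (f t))}.
  have [M' M'1 MP'] := sg_bounded (N + N).
  have M'0 : 0 < M' by rewrite (lt_le_trans ltr01).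
  apply: (@rint_param_continuous R f 0 N (M' * c + M' * c)).
  - by move=> t; apply: continuous_hnorm => s; apply: cvgB; exact: ch.
  - move=> s; apply: continuous_hnorm => t; apply: cvgB; last exact: cvg_cst.
    apply: (@sg_app_continuous (fun t => t - s) (fun=> B (g s))) => [r|r].
      by apply: cvgB => //; exact: cvg_cst.
    exact: cst_continuous.
  - move=> t s tt sN; rewrite ger0_norm ?hnorm_ge0//.
    have b r : `|r - t1| < 1 -> hnorm (h r s) <= M' * c.
      move=> rt; rewrite (le_trans (MP' _ _ _))//; last by rewrite ler_pM2l// cP.
      rewrite normr_ge0 /= ler_norml; move: rt sN; rewrite ltr_norml.
      by rewrite /N => /andP[? ?] /andP[? ?]; apply/andP; split; lra.
    by rewrite (le_trans (hnormB _ _))// lerD ?b// subrr normr0.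
have f0 : rint 0 N (f t1) = 0.
  rewrite (@rint_ext _ _ _ _ (fun=> 0)) ?rint_cst ?mul0r//.
  by move=> s _; rewrite /f subrr hnorm0.
have Mc : 0 <= M * c by exact: mulr_ge0 (ltW M0) c0.
have Mc0 : 0 < M * c + 1 by rewrite ltr_wpDl.
have e2 : 0 < e / 2 by rewrite divr_gt0.
have [d1 /= d10 d1P] : \forall t \near t1, rint 0 N (f t) < e / 2.
  move/cvgrPdist_lt : fint => /(_ _ e2); apply: filterS => t.
  rewrite f0 sub0r normrN => /(le_lt_trans _); apply; exact: ler_norm.
exists (Num.min (Num.min 1 d1) (e / 2 / (M * c + 1))).
  by rewrite !lt_min ltr01 d10 divr_gt0.
move=> t t0; rewrite !lt_min -andbA => /and3P[tt1 td1 te].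
have step (a b : R) : 0 <= a -> a <= b -> b <= N ->
    hnorm (duhamel g b - duhamel g a) <=
    rint 0 N (fun s => hnorm (h b s - h a s)) + M * c * (b - a).
  move=> a0 ab bN; have b0 := le_trans a0 ab.
  rewrite /duhamel -/(h a) -/(h b) (wint_chasles (b := a))// addrAC.
  rewrite -wintN// -wintD//; last by move=> s; apply: cvgN; exact: ch.
  have cd : continuous (fun s => h b s - h a s) by move=> s; apply: cvgB; exact: ch.
  rewrite (le_trans (hnormD _ _))// lerD//.
    rewrite (rint_chasles (b := a))//; [|exact: continuous_hnorm|exact: le_trans ab bN].
    rewrite -[leLHS]addr0 lerD//; last by apply: rint_ge0 => s _; exact: hnorm_ge0.
    by apply: wint_le => //; exact: continuous_hnorm.
  apply: wint_bound => // s /andP[as_ sb]; apply: hle; rewrite ?b0 ?bN//.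
  by rewrite (le_trans a0 as_) (le_trans sb).
have tN : t <= N by move: tt1; rewrite /N ltr_norml => /andP[? ?]; lra.
have fin : rint 0 N (f t) + M * c * `|t - t1| < e.
  rewrite (splitr e) ltr_leD//; first by apply: d1P; rewrite /= distrC.
  rewrite (@le_trans _ _ ((M * c + 1) * `|t - t1|))//.
    by rewrite ler_wpM2r// lerDl.
  by rewrite mulrC -ler_pdivlMr// ltW.
have t1N : t1 <= N by rewrite lerDl.
have [t1t|tt1'] := leP t1 t.
  rewrite (le_lt_trans (step _ _ t10 t1t tN))//.
  by move: fin; rewrite (ger0_norm (_ : 0 <= t - t1)) ?subr_ge0.
rewrite hnorm_subC (le_lt_trans (step _ _ t0 (ltW tt1') t1N))//.
move: fin; rewrite distrC (ger0_norm (_ : 0 <= t1 - t)) ?subr_ge0 ?ltW//.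
congr (_ + _ < _); apply: rint_ext => s _; exact: hnorm_subC.
Qed.

(** The weight gains a factor [1 / lam] from integrating [expR (lam * s)]; the
    choice [lam = 2 M b], with [M] and [b] bounds for [T] and [B], makes the
    product of all constants equal to [1 / 2]. *)
Lemma duhamel_contraction (N : R) : exists2 lam : R, 0 < lam &
  forall (g : R -> H) (c : R), continuous g -> 0 <= c ->
    (forall s : R, 0 <= s <= N -> hnorm (g s) <= c * expR (lam * s)) ->
    forall t : R, 0 <= t <= N -> hnorm (duhamel g t) <= c / 2 * expR (lam * t).
Proof.
have [M M1 MP] := sg_bounded N; have M0 : 0 < M by rewrite (lt_le_trans ltr01).
have [b b0 bP] := bop_le B.
have lam0 : 0 < 2 * (M * b) by rewrite !mulr_gt0.
exists (2 * (M * b)) => // g c cg c0 gc t /andP[t0 tN].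
set lam := 2 * (M * b) in lam0 gc *.
have cexp : continuous (fun s : R => expR (lam * s)).
  move=> s; apply: (@continuous_comp _ _ _ (fun s => lam * s) expR).
    by apply: cvgM => //; exact: cvg_cst.
  exact: continuous_expR.
rewrite (le_trans (wint_le (phi := fun s => M * b * c * expR (lam * s)) _ _ _))//.
- exact: duhamel_integrand.
- by move=> s; apply: cvgM; [exact: cvg_cst|exact: cexp].
- move=> s /andP[s0 st].
  have sN : 0 <= s <= N by rewrite s0 (le_trans st).
  rewrite (le_trans (MP _ _ _))//.
    rewrite normr_ge0 ger0_norm ?subr_ge0//=; lra.
  rewrite -2!mulrA ler_pM2l// (le_trans (bP _))// ler_pM2l//.
  exact: gc.
- rewrite rintZ// (le_trans (ler_wpM2l _ (rint_expR lam0 t0)))//.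
    by rewrite mulr_ge0// mulr_ge0 ?ltW.
  suff -> : M * b * c * (expR (lam * t) / lam) = c / 2 * expR (lam * t) by [].
  by rewrite /lam; field; rewrite !gt_eqF.
Qed.

(** Iterating [|g| <= a + |duhamel g|] with the contraction estimate leaves the
    bound [2 a + c / 2 ^+ n] in the weighted norm, whatever the initial bound
    [c]. *)
Lemma duhamel_gronwall (N : R) : exists2 K : R, 0 < K &
  forall (g : R -> H) (a : R), continuous g -> 0 <= a ->
    (forall t : R, 0 <= t <= N -> hnorm (g t - duhamel g t) <= a) ->
    forall t : R, 0 <= t <= N -> hnorm (g t) <= K * a.
Proof.
have [lam lam0 contr] := duhamel_contraction N.
exists (2 * expR (lam * N)) => [|g a cg a0 ga t tN].
  by rewrite mulr_gt0// expR_gt0.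
have [c c0 cP] := continuous_bound N (continuous_hnorm cg).
have exp_ge1 (s : R) : 0 <= s -> 1 <= expR (lam * s).
  by move=> s0; rewrite -expR0 ler_expR mulr_ge0// ltW.
have iter (n : nat) (s : R) : 0 <= s <= N ->
    hnorm (g s) <= (2 * a + c / 2 ^+ n) * expR (lam * s).
  elim: n s => [|n IH] s sN; have s0 : 0 <= s by case/andP: sN.
    rewrite expr0 divr1 (le_trans (cP s sN))// (@le_trans _ _ (2 * a + c))//.
      by rewrite lerDr mulr_ge0.
    by rewrite ler_peMr ?exp_ge1// addr_ge0// mulr_ge0.
  have h0 : 0 <= 2 * a + c / 2 ^+ n.
    by rewrite addr_ge0// ?mulr_ge0// divr_ge0// exprn_ge0.
  rewrite (le_trans (hnorm_le_dist _ (duhamel g s)))//.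
  rewrite (le_trans (lerD (ga s sN) (contr g _ cg h0 IH s sN)))//.
  have -> : (2 * a + c / 2 ^+ n.+1) * expR (lam * s) =
      a * expR (lam * s) + (2 * a + c / 2 ^+ n) / 2 * expR (lam * s).
    by rewrite exprS; field; rewrite expf_neq0// lt0r_neq0.
  by rewrite lerD2r ler_peMr// exp_ge1.
apply: (@geometric_le _ _ _ (c * expR (lam * N))).
  by rewrite mulr_ge0// expR_ge0.
move=> n; rewrite (le_trans (iter n t tN))//.
have -> : 2 * expR (lam * N) * a + c * expR (lam * N) / 2 ^+ n =
  (2 * a + c / 2 ^+ n) * expR (lam * N) by ring.
rewrite ler_wpM2l//.
  by rewrite addr_ge0// ?mulr_ge0// divr_ge0// exprn_ge0.
by rewrite ler_expR ler_pM2l//; case/andP: tN.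
Qed.

(** Picard iteration from [0].  On a bounded time interval consecutive iterates
    differ by at most a constant times [2 ^- n], so the limit is locally uniform
    and therefore continuous. *)
Lemma mild_solution (a : R -> H) : continuous (fun t : R => a `|t|) ->
  exists2 u : R -> H, continuous u &
    forall t : R, 0 <= t -> u t = a t + duhamel u t.
Proof.
move=> ca.
pose fix U n := if n is m.+1 then (fun t : R => a `|t| + duhamel (U m) `|t|)
  else (fun=> 0).
have cU n : continuous (U n).
  elim: n => [|n IH] /=; first by move=> t; exact: cvg_cst.
  by move=> t; apply: cvgD; [exact: ca|exact: duhamel_continuous].
have dsub f g t : continuous f -> continuous g ->
    duhamel f t - duhamel g t = duhamel (fun s => f s - g s) t.
  move=> cf cg; have := @duhamel_linear (-1) g f t cg cf.
  rewrite scaleN1r addrC => <-; congr duhamel; apply/funext => s.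
  by rewrite scaleN1r addrC.
have csub f g : continuous f -> continuous g ->
    continuous (fun s : R => f s - g s : H).
  by move=> cf cg s; apply: cvgB; [exact: cf|exact: cg].
have diff (N : R) : exists2 C : R, 0 <= C & forall n (t : R), `|t| <= N ->
    hnorm (U n.+1 t - U n t) <= C / 2 ^+ n.
  have [lam lam0 contr] := duhamel_contraction N.
  have [c c0 cP] := continuous_bound N (continuous_hnorm ca).
  have step n (t : R) : 0 <= t <= N ->
      hnorm (U n.+1 t - U n t) <= c / 2 ^+ n * expR (lam * t).
    elim: n t => [|n IH] t /andP[t0 tN].
      rewrite expr0 divr1 [U 0%N t]/= subr0 [U 1%N t]/=.
      have -> : duhamel (fun=> 0) `|t| = 0.
        apply: wint_unique => [|z].
          by apply: duhamel_integrand => s; exact: cvg_cst.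
        rewrite rdot0r (@rint_ext _ _ _ _ (fun=> 0)) ?rint_cst ?mul0r//.
        by move=> s _; rewrite !linear0 rdot0r.
      rewrite addr0 (le_trans (cP t _)) ?t0// ler_peMr// -expR0 ler_expR.
      by rewrite mulr_ge0// ltW.
    rewrite [U n.+2]/= [X in _ - X]/= opprD addrACA subrr add0r dsub//; last exact: (cU n.+1).
    rewrite ger0_norm// exprS.
    have -> : c / (2 * 2 ^+ n) = c / 2 ^+ n / 2.
      by field; rewrite expf_neq0// lt0r_neq0.
    apply: (contr (fun s => U n.+1 s - U n s)); last 2 first.
    - exact: IH.
    - by rewrite t0.
    - exact: csub (cU n.+1) (cU n).
    - by rewrite divr_ge0// exprn_ge0.
  exists (c * expR (lam * N)) => [|n t tN]; first by rewrite mulr_ge0// expR_ge0.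
  have even m : U m t = U m `|t| by case: m => //= m; rewrite normr_id.
  rewrite !even (le_trans (step n `|t| _)) ?normr_ge0//.
  rewrite mulrAC ler_wpM2r ?invr_ge0 ?exprn_ge0// ler_wpM2l//.
  by rewrite ler_expR ler_pM2l.
have /choice[u uP] (t : R) : exists l, forall C : R, 0 <= C ->
    (forall n, hnorm (U n.+1 t - U n t) <= C / 2 ^+ n) ->
    forall n, hnorm (U n t - l) <= 2 * C / 2 ^+ n.
  apply: geometric_cvg; have [C C0 CP] := diff `|t|.
  by exists C => // n; exact: CP.
have unif (N : R) : exists2 C : R, 0 <= C & forall n (t : R), `|t| <= N ->
    hnorm (U n t - u t) <= C / 2 ^+ n.
  have [C C0 CP] := diff N; exists (2 * C) => [|n t tN]; first by rewrite mulr_ge0.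
  by apply: uP => // m; exact: CP.
have cu : continuous u.
  move=> t0; apply/cvg_hnormP => e e0.
  have [C C0 CP] := unif (`|t0| + 1).
  have e3 : 0 < e / 3 by rewrite divr_gt0.
  have [n nP] := geometric_small C0 e3.
  near=> t.
  have h1 : hnorm (U n t - U n t0) < e / 3.
    by near: t; move/cvg_hnormP : (cU n t0); apply.
  have h2 : `|t0 - t| < 1 by near: t; exists 1 => //=.
  have h3 : `|t| <= `|t0| + 1.
    have := ler_normB t0 (t0 - t); rewrite opprB addrC subrK.
    by move/le_trans; apply; rewrite lerD2l ltW.
  have h4 : `|t0| <= `|t0| + 1 by rewrite lerDl.
  have := CP n t h3; have := CP n t0 h4.
  have := hnorm_tri (U n t) (u t) (u t0); have := hnorm_tri (U n t0) (U n t) (u t0).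
  rewrite (hnorm_subC (u t) (U n t)); lra.
exists u => // t t0; apply/subr0_eq/hnorm_eq0/le_anti; rewrite hnorm_ge0 andbT.
have [lam lam0 contr] := duhamel_contraction t.
have [C C0 CP] := unif t.
apply: (@geometric_le _ _ _ (C + C * expR (lam * t))).
  by rewrite addr_ge0// mulr_ge0// expR_ge0.
move=> n; have p2 : 0 < 2 ^+ n :> R by rewrite exprn_gt0.
have := CP n.+1 t; rewrite ger0_norm// => /(_ (lexx _)) h1.
have h2 : hnorm (duhamel (U n) t - duhamel u t) <= C / 2 ^+ n / 2 * expR (lam * t).
  rewrite dsub//; apply: (contr (fun s => U n s - u s)); rewrite ?t0 ?lexx//.
  - exact: csub.
  - by rewrite divr_ge0// ltW.
  - move=> s /andP[s0 st]; rewrite (le_trans (CP n s _)) ?ger0_norm//.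
    by rewrite ler_peMr ?divr_ge0 ?(ltW p2)// -expR0 ler_expR mulr_ge0// ltW.
have -> : u t - (a t + duhamel u t) =
    - (U n.+1 t - u t) + (duhamel (U n) t - duhamel u t).
  by rewrite /= ger0_norm//; hilbert_ring.
rewrite (le_trans (hnormD _ _))// hnormN add0r mulrDl (le_trans (lerD h1 h2))//.
rewrite lerD//.
  rewrite ler_wpM2l// lef_pV2 ?posrE ?exprn_gt0// exprS ler_peMl ?(ltW p2)//.
  by rewrite ler1n.
rewrite [leRHS]mulrAC ler_wpM2r ?expR_ge0// ler_pdivrMr// ler_peMr ?ler1n//.
by rewrite divr_ge0// ltW.
Unshelve. all: by end_near. Qed.

Lemma mild_unique (f g : R -> H) (t : R) : continuous f -> continuous g ->
  (forall s : R, 0 <= s <= t -> f s - g s = duhamel f s - duhamel g s) ->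
  0 <= t -> f t = g t.
Proof.
move=> cf cg h t0; have [K _ KP] := duhamel_gronwall t.
have cd : continuous (fun s => f s - g s) by move=> s; apply: cvgB; [exact: cf|exact: cg].
apply/subr0_eq/hnorm_eq0/le_anti; rewrite hnorm_ge0 andbT -(mulr0 K).
apply: (KP (fun s => f s - g s)); rewrite ?t0 ?lexx// => s st.
have -> : duhamel (fun s => f s - g s) s = duhamel f s - duhamel g s.
  have := @duhamel_linear (-1) g f s cg cf.
  rewrite scaleN1r addrC => <-; congr duhamel; apply/funext => r.
  by rewrite scaleN1r addrC.
by rewrite h// subrr hnorm0.
Qed.

(** Splitting the integral at [s] is what turns Duhamel's equation into the
    semigroup law. *)
Lemma duhamel_shift (g : R -> H) (r s : R) : continuous g -> 0 <= r -> 0 <= s ->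
  duhamel g (r + s) = T r (duhamel g s) + duhamel (fun t => g (t + s)) r.
Proof.
move=> cg r0 s0; rewrite /duhamel (wint_chasles (b := s)) ?lerDr//; last first.
  exact: duhamel_integrand.
congr (_ + _).
  rewrite wint_bop; last exact: duhamel_integrand.
  apply: wint_ext => q /andP[q0 qs].
  have sq : 0 <= s - q by rewrite subr_ge0.
  by rewrite -addrA (ger0_norm (addr_ge0 r0 sq)) (ger0_norm sq) sgD.
rewrite -{1}[s]add0r wint_shift; last exact: duhamel_integrand.
by apply: wint_ext => q _; congr (T `|_| _); ring.
Qed.

(** The derivative at time [0] is [B (g 0)]: this is the amount by which the
    generator changes. *)
Lemma duhamel_diff0 (g : R -> H) (e : R) : continuous g -> 0 < e ->
  exists2 d : R, 0 < d & forall t : R, 0 <= t < d ->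
    hnorm (duhamel g t - sreal k t *: B (g 0)) <= e * t.
Proof.
move=> cg e0.
have [M M1 MP] := sg_bounded 1; have M0 : 0 < M by rewrite (lt_le_trans ltr01).
have e2 : 0 < e / 2 by rewrite divr_gt0.
have [d d0 dP] := sg_near0 (B (g 0)) e2.
have /cvg_hnormP/(_ _ (divr_gt0 e2 M0)) [d' /= d'0 d'P] :=
  continuous_bop (L := B) cg (x := 0).
exists (Num.min 1 (Num.min d d')); first by rewrite !lt_min ltr01 d0.
move=> t /andP[t0]; rewrite !lt_min => /and3P[t1 td td'].
have -> : sreal k t *: B (g 0) = wint 0 t (fun=> B (g 0)).
  by rewrite wint_cst// subr0.
rewrite -wintN; last exact: cst_continuous.
rewrite -wintD; [|exact: duhamel_integrand|exact: cst_continuous].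
rewrite -[X in _ <= e * X]subr0; apply: wint_bound => // [|s /andP[s0 st]].
  by move=> s; apply: cvgD; [exact: duhamel_integrand|exact: cvg_cst].
have ts : 0 <= t - s by rewrite subr_ge0.
rewrite (ger0_norm ts) ltW// (le_lt_trans (hnorm_tri (T (t - s) (B (g 0))) _ _))//.
rewrite (splitr e) ltrD//; last by apply: dP; rewrite ts /=; lra.
rewrite -linearB (le_lt_trans (MP _ _ _)) ?ts//=; first lra.
rewrite mulrC -ltr_pdivlMr//; apply: d'P.
by rewrite /= sub0r normrN ger0_norm//; lra.
Qed.

(** [S t x] is the solution at time [t] of Duhamel's equation started at [x].
    Linearity in [x] and the semigroup law follow from uniqueness, boundedness
    from the Gronwall estimate. *)
Lemma perturbed_semigroup : exists S : R -> 'L(H, H), C0_semigroup S /\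
  forall x (e : R), 0 < e -> exists2 d : R, 0 < d & forall t : R, 0 < t < d ->
    hnorm (difference_quotient S x t - difference_quotient T x t - B x) <= e.
Proof.
have /choice[u uP] (x : H) : exists u : R -> H, continuous u /\
    forall t : R, 0 <= t -> u t = T t x + duhamel u t.
  have [u cu uP] := @mild_solution (fun t => T t x) (@sg_continuous x).
  by exists u.
have cu x : continuous (u x) by have [] := uP x.
have ueq x (t : R) : 0 <= t -> u x t = T t x + duhamel (u x) t.
  by have [_] := uP x; apply.
have u0 x : u x 0 = x by rewrite ueq// duhamel0// addr0 sg0.
have ulin (t : R) (c : scalar_field R k) x y : 0 <= t ->
    u (c *: x + y) t = c *: u x t + u y t.
  move=> t0; have cc : continuous (fun s => c *: u x s + u y s).
    by move=> s; apply: cvgD; [apply: cvgZr; exact: cu|exact: cu].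
  apply: (@mild_unique _ (fun s => c *: u x s + u y s)) => // s /andP[s0 _].
  by rewrite duhamel_linear// !ueq// linearP; hilbert_ring.
have ubound (t : R) : 0 <= t -> exists K : R, forall x, hnorm (u x t) <= K * hnorm x.
  move=> t0; have [K K0 KP] := duhamel_gronwall t.
  have [M M1 MP] := sg_bounded t; have M0 : 0 < M by rewrite (lt_le_trans ltr01).
  exists (K * M) => x; rewrite -mulrA; apply: KP; rewrite ?t0 ?lexx//.
    by rewrite mulr_ge0 ?hnorm_ge0// ltW.
  move=> s /andP[s0 st]; rewrite ueq// addrK; apply: MP.
  by rewrite s0.
have usg (s t : R) x : 0 <= s -> 0 <= t -> u x (s + t) = u (u x t) s.
  move=> s0 t0.
  apply: (@mild_unique (fun r => u x (r + t)) (u (u x t)) s) => //.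
    exact: continuous_shiftr.
  move=> r /andP[r0 _]; rewrite ueq ?addr_ge0// duhamel_shift// sgD//.
  have e : T r (u x t) = T r (T t x) + T r (duhamel (u x) t).
    by rewrite -linearD -ueq.
  by rewrite [u (u x t) r]ueq// e; hilbert_ring.
have /choice[S SP] (t : R) : exists S : 'L(H, H), 0 <= t -> forall x, S x = u x t.
  have [t0|t0] := leP 0 t; last by exists (T 0).
  have [K KP] := ubound t t0.
  have [L LE] := @mk_bop _ _ H H (fun x => u x t) K (fun c x y => ulin t c x y t0) KP.
  by exists L.
exists S; split.
  split => [x|s t s0 t0 x|x]; first by rewrite SP.
    by rewrite !SP ?addr_ge0// usg.
  apply/cvg_hnormP => e e0; have /cvg_hnormP/(_ _ e0) [d /= d0 dP] := cu x 0.
  exists d => // t /= td t0; rewrite SP ?ltW//.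
  by have := dP _ td; rewrite u0.
move=> x e e0; have [d d0 dP] := duhamel_diff0 (cu x) e0.
exists d => // t /andP[t0 td].
have -> : difference_quotient S x t - difference_quotient T x t - B x =
    sreal k t^-1 *: (duhamel (u x) t - sreal k t *: B (u x 0)).
  rewrite /difference_quotient -srealV SP ?ltW// ueq ?ltW// u0.
  apply: rdot_inj => z; rewrite !(rdotBr, rdotZr, rdotDr).
  by field; rewrite gt_eqF.
have ti : 0 <= t^-1 by rewrite invr_ge0 ltW.
rewrite hnorm_sreal (ger0_norm ti) ler_pdivrMl// mulrC.
by apply: dP; rewrite ltW.
Qed.

End Duhamel.

(** The difference quotients of the two semigroups differ by a function that
    converges to [B x], so that one converges exactly when the other does. *)
Lemma bounded_perturbation (A : unbounded_op H) (B : 'L(H, H)) (Bf : H -> H) :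
  generates A T -> (forall x, Bf x = B x) ->
  exists S : R -> 'L(H, H), C0_semigroup S /\ generates (perturb A Bf) S.
Proof.
move=> [domA AP] BE; have [S [HS SP]] := perturbed_semigroup B.
have dqB x : difference_quotient S x t - difference_quotient T x t @[t --> 0^'+]
    --> B x.
  apply/cvg_hnormP => e e0; have e2 : 0 < e / 2 by rewrite divr_gt0.
  have [d d0 dP] := SP x _ e2.
  exists d => // t /=; rewrite sub0r normrN => td t0.
  rewrite (le_lt_trans (dP t _)) ?ltr_pdivrMr ?ltr_pMr ?ltr1n//.
  by rewrite t0 -(gtr0_norm t0).
have toS x l : difference_quotient T x t @[t --> 0^'+] --> l ->
    difference_quotient S x t @[t --> 0^'+] --> l + B x.
  move=> xl.
  have -> : difference_quotient S x = fun t =>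
      difference_quotient T x t + (difference_quotient S x t - difference_quotient T x t).
    by apply/funext => t; rewrite addrC subrK.
  by apply: cvgD; [exact: xl|exact: dqB].
have toT x l : difference_quotient S x t @[t --> 0^'+] --> l ->
    difference_quotient T x t @[t --> 0^'+] --> l - B x.
  move=> xl.
  have -> : difference_quotient T x = fun t =>
      difference_quotient S x t - (difference_quotient S x t - difference_quotient T x t).
    by apply/funext => t; rewrite subKr.
  by apply: cvgB; [exact: xl|exact: dqB].
exists S; split => //; split => [|x /= dx]; last by rewrite BE; apply: toS; exact: AP.
rewrite /= domA; apply/seteqP; split => x /= /cvg_ex[l xl]; apply/cvg_ex.
  by exists (l + B x); exact: toS.
by exists (l - B x); exact: toT.
Qed.

End Semigroups.

(** * The Lyapunov operator of a square-integrable semigroup *)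

Section Lyapunov.
Context (R : realType) (k : scalars) (H : hilbertType R k).
Context (T : R -> 'L(H, H)) (HT : C0_semigroup T).
Context (sqT : forall x : H, square_integrable (fun t => T t x)).
Local Notation mu := (@lebesgue_measure R).
Local Notation D := (`[0%R, +oo[%classic : set (measurableTypeR R)).

(** The real part of the form of the infinite-horizon Gramian, the integral of
    [T(t)^* T(t)] over [t >= 0]. *)
Definition energy (x y : H) : R := \int[mu]_(t in D) rdot (T t x) (T t y).

(** By polarisation, measurability and integrability are inherited from the
    squared norms of orbits. *)
Lemma energy_integrable (x y : H) :
  mu.-integrable D (EFin \o (fun t => rdot (T t x) (T t y))).
Proof.
have -> : EFin \o (fun t => rdot (T t x) (T t y)) =
    (fun t => (4^-1)%:E * ((hnorm (T t (x + y)) ^+ 2)%:E - (hnorm (T t (x - y)) ^+ 2)%:E))%E.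
  apply/funext => t /=; rewrite -EFinB -EFinM linearD linearB !hnorm_sqrD.
  by rewrite rdotNr hnormN; congr (_%:E); field.
by apply: integrableZl => //; apply: integrableB => //; exact: sqT.
Qed.

Lemma energyC x y : energy x y = energy y x.
Proof. by apply: eq_Rintegral => t _; rewrite rdotC. Qed.

Lemma energyDl x y z : energy (x + y) z = energy x z + energy y z.
Proof.
rewrite -RintegralD//; [|exact: energy_integrable..].
by apply: eq_Rintegral => t _; rewrite linearD rdotDl.
Qed.

Lemma energyZl t x y : energy (sreal k t *: x) y = t * energy x y.
Proof.
rewrite -RintegralZl//; last exact: energy_integrable.
by apply: eq_Rintegral => s _; rewrite linearZ rdotZl.
Qed.

Lemma energyDr x y z : energy x (y + z) = energy x y + energy x z.
Proof. by rewrite energyC energyDl !(energyC _ x). Qed.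

Lemma energyZr t x y : energy x (sreal k t *: y) = t * energy x y.
Proof. by rewrite energyC energyZl energyC. Qed.

Lemma energyBl x y z : energy (x - y) z = energy x z - energy y z.
Proof. by rewrite -scaleN1r -(sreal1 R k) -srealN energyDl energyZl mulN1r. Qed.

Lemma energyBr x y z : energy x (y - z) = energy x y - energy x z.
Proof. by rewrite energyC energyBl !(energyC _ x). Qed.

Lemma energy_conj (c : scalar_field R k) x y : energy (c *: x) y = energy x (sconj c *: y).
Proof. by apply: eq_Rintegral => t _; rewrite !linearZ rdot_conj. Qed.

Lemma energy_ge0 x : 0 <= energy x x.
Proof. by apply: Rintegral_ge0 => t _; rewrite rdotxx sqr_ge0. Qed.

Lemma EFin_energy x : ((energy x x)%:E = \int[mu]_(t in D) (hnorm (T t x) ^+ 2)%:E)%E.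
Proof.
rewrite /energy fineK; last exact: integrable_fin_num (energy_integrable x x).
by apply: eq_integral => t _; rewrite /= rdotxx.
Qed.

Lemma energy_lsc (c : R) (u : nat -> H) (x : H) : u @ \oo --> x ->
  (forall n, energy (u n) (u n) <= c) -> energy x x <= c.
Proof.
move=> ux uc; rewrite -lee_fin EFin_energy.
pose f n t := ((hnorm (T t (u n)) ^+ 2)%:E : \bar R).
have lim t : limn_einf (f ^~ t) = (hnorm (T t x) ^+ 2)%:E.
  have ft : f ^~ t @ \oo --> ((hnorm (T t x) ^+ 2)%:E : \bar R).
    apply: cvg_EFin; first by near=> n.
    apply: (@cvg_trans _ (hnorm (T t (u n)) ^+ 2 @[n --> \oo])) => //.
    rewrite !expr2; have h : hnorm (T t (u n)) @[n --> \oo] --> hnorm (T t x).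
      by apply: cvg_hnorm; apply: bop_cvg.
    by apply: cvgM.
  rewrite is_cvg_limn_einfE; last by apply/cvg_ex; eexists; exact: ft.
  exact: (cvg_lim _ ft).
have -> : (\int[mu]_(t in D) (hnorm (T t x) ^+ 2)%:E =
    \int[mu]_(t in D) limn_einf (f ^~ t))%E.
  by apply: eq_integral => t _; rewrite lim.
rewrite (le_trans (fatou mu _ _ _))//.
- by move=> n; have /integrableP[] := sqT (u n).
- by move=> n t _; rewrite lee_fin sqr_ge0.
rewrite limn_einf_lim; apply: lime_le; first exact: is_cvg_einfs.
apply: nearW => n; apply: (@le_trans _ _ (\int[mu]_(t in D) f n t)%E).
  by apply: ereal_inf_lbound; exists n => /=.
by rewrite -EFin_energy lee_fin.
Unshelve. all: by end_near. Qed.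

(** The form is finite on the diagonal, where it is lower semicontinuous, hence
    bounded; non-negativity then bounds it off the diagonal, as in the proof of
    the Cauchy-Schwarz inequality. *)
Lemma energy_bounded : exists2 K : R, 0 < K &
  forall x y, energy x y <= K * hnorm x * hnorm y.
Proof.
have par x y : energy (x - y) (x - y) <= 2 * (energy x x + energy y y).
  have := energy_ge0 (x + y).
  by rewrite !(energyDl, energyDr, energyBl, energyBr) (energyC y x); lra.
have [x|r r0 [c cP]] := @uniform_boundedness R k H unit (fun _ x => energy x x)
  (fun _ => par) (fun _ => @energy_lsc); first by exists (energy x x).
have c0 : 0 <= c.
  by rewrite (le_trans (energy_ge0 0))// (cP tt)// hnorm0 ltW.
pose K := c / r ^+ 2 + 1.
have K0 : 0 < K by rewrite ltr_wpDl// divr_ge0// exprn_ge0// ltW.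
have en0 y : energy 0 y = 0.
  by rewrite -(subrr (0 : H)) energyBl subrr.
have diag x : energy x x <= K * hnorm x ^+ 2.
  have [x0|/hnorm_gt0 xp] := eqVneq (hnorm x) 0.
    by rewrite (hnorm_eq0 x0) en0 hnorm0 expr0n mulr0.
  have q0 : 0 <= r / hnorm x by rewrite divr_ge0 ?ltW.
  have := cP tt (sreal k (r / hnorm x) *: x).
  rewrite hnorm_sreal (ger0_norm q0) divfK ?gt_eqF// => /(_ (lexx _)).
  rewrite energyZl energyZr mulrA -expr2 expr_div_n mulrAC ler_pdivrMr ?exprn_gt0// => h.
  have : energy x x <= c / r ^+ 2 * hnorm x ^+ 2.
    by rewrite mulrAC ler_pdivlMr ?exprn_gt0// mulrC.
  by move/le_trans; apply; rewrite ler_wpM2r ?exprn_ge0 ?hnorm_ge0// /K lerDl.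
exists K => // x y.
have [x0|/hnorm_gt0 xp] := eqVneq (hnorm x) 0.
  by rewrite (hnorm_eq0 x0) en0 hnorm0 mulr0 mul0r.
have [y0|/hnorm_gt0 yp] := eqVneq (hnorm y) 0.
  by rewrite (hnorm_eq0 y0) energyC en0 hnorm0 mulr0.
have := energy_ge0 (sreal k (hnorm y) *: x - sreal k (hnorm x) *: y).
rewrite !(energyBl, energyBr, energyZl, energyZr) (energyC y x) => h.
have := ler_wpM2l (sqr_ge0 (hnorm y)) (diag x).
have := ler_wpM2l (sqr_ge0 (hnorm x)) (diag y) => h1 h2.
rewrite -(ler_pM2l (mulr_gt0 xp yp)); nra.
Qed.

(** The energy of [T t x] is that part of the energy of [x] spent after time [t];
    the part spent before is close to [t * hnorm x ^+ 2]. *)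
Lemma energy_decay (x : H) (e : R) : 0 < e -> exists2 d : R, 0 < d &
  forall t : R, 0 < t < d ->
    energy (T t x) (T t x) <= energy x x - t * (hnorm x ^+ 2 - e).
Proof.
move=> e0.
have cn : (fun t : R => hnorm (T `|t| x) ^+ 2) @ 0 --> hnorm x ^+ 2.
  have h : (fun t : R => hnorm (T `|t| x)) @ 0 --> hnorm x.
    apply: cvg_hnorm; have := @sg_continuous _ _ _ _ HT x 0.
    by rewrite /continuous_at normr0 sg0.
  by rewrite expr2; under eq_fun do rewrite expr2; apply: cvgM.
move/cvgrPdist_lt : cn => /(_ _ e0) [d /= d0 dP].
exists d => // t /andP[t0 td].
have int0t : mu.-integrable `[0, t] (EFin \o (fun s => rdot (T s x) (T s x))).
  apply: integrableS (energy_integrable x x) => //.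
  by apply: subset_itvl; rewrite bnd_simp.
have split_at_t : energy x x - \int[mu]_(s in `[0, t]) rdot (T s x) (T s x) =
    \int[mu]_(s in `[t, +oo[) rdot (T s x) (T s x).
  rewrite -Rintegral_itv_obnd_cbnd.
    by apply: Rintegral_itvB; rewrite ?bnd_simp// ?(ltW t0)//; exact: energy_integrable.
  apply: integrableS (energy_integrable x x) => //.
  by apply: subset_itvr; rewrite bnd_simp ltW.
have shifted : energy (T t x) (T t x) =
    \int[mu]_(s in `[t, +oo[) rdot (T s x) (T s x).
  rewrite /energy /Rintegral [in RHS](ge0_integral_shift t)//.
  - congr fine; rewrite (_ : _ @^-1` _ = D).
      by apply: eq_integral => s; rewrite inE /= in_itv /= andbT => s0; rewrite !sgD// ltW.
    by apply/seteqP; split=> s /=; rewrite !in_itv /= !andbT lerDr.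
  - have /integrableP[mf _] := energy_integrable x x.
    apply: measurable_funS mf => //.
    by apply: subset_itvr; rewrite bnd_simp ltW.
  - by move=> s _; rewrite lee_fin rdotxx sqr_ge0.
rewrite shifted -split_at_t lerD2l lerN2.
have cst : mu.-integrable `[0, t] (EFin \o (fun=> hnorm x ^+ 2 - e)).
  exact: (@rint_integrable R 0 t (fun=> hnorm x ^+ 2 - e) (fun s => @cst_continuous _ _ _ s)).
have <- : rint 0 t (fun=> hnorm x ^+ 2 - e) = t * (hnorm x ^+ 2 - e).
  by rewrite rint_cst ?(ltW t0)// subr0 mulrC.
apply: le_Rintegral => // s; rewrite /= in_itv /= => /andP[s0 st].
have := dP s; rewrite /= sub0r normrN (ger0_norm s0) rdotxx.
move=> /(_ (le_lt_trans st td)); rewrite ltr_norml => /andP[_]; lra.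
Qed.

(** Compare [energy_decay] with the expansion
    [b(y, y) - b(x, x) = 2 b(y - x, x) + b(y - x, y - x)] for [y = T t x], whose last
    term is non-negative, divide by [t] and let [t] tend to [0]. *)
Lemma lyapunov_operator (A : unbounded_op H) : generates A T ->
  exists P : 'L(H, H), [/\ self_adjoint P, nonneg_op P &
    forall x, dom A x -> 2 * rdot (A x) (P x) <= - hnorm x ^+ 2].
Proof.
move=> [_ AP]; have [K K0 KP] := energy_bounded.
have [||||||P PE] := @riesz_bop R k H H energy K.
- by move=> y u v; exact: energyDl.
- by move=> u x y; exact: energyDr.
- by move=> t u y; exact: energyZl.
- by move=> c u y; exact: energy_conj.
- exact: ltW.
- exact: KP.
have Psa : self_adjoint P.
  by apply/self_adjointP => x y; rewrite rdotC !PE energyC.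
exists P; split => //.
  by apply: self_adjoint_nonneg => // x; rewrite rdotC PE energy_ge0.
move=> x dx; apply/ler_addgt0Pr => e e0.
have e2 : 0 < e / 2 by rewrite divr_gt0.
have [d d0 dP] := energy_decay x e2.
have dq : rdot (difference_quotient T x t) (P x) @[t --> 0^'+] --> rdot (A x) (P x).
  by apply: cvg_rdot; [exact: AP|exact: cvg_cst].
have e4 : 0 < e / 4 by rewrite divr_gt0.
move/cvgrPdist_lt : dq => /(_ _ e4) [d' /= d'0 d'P].
pose t := Num.min d d' / 2.
have dd' : 0 < Num.min d d' by rewrite lt_min d0.
have t0 : 0 < t by rewrite divr_gt0.
have tm : t < Num.min d d' by rewrite ltr_pdivrMr// ltr_pMr// ltr1n.
move: tm; rewrite lt_min => /andP[td td'].
have := d'P t; rewrite /= sub0r normrN gtr0_norm// => /(_ td' t0).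
rewrite /difference_quotient -srealV rdotZl (PE (T t x - x)) energyBl => h1.
have h2 := dP t; rewrite t0 td /= in h2; have {h2} := h2 isT.
have := energy_ge0 (T t x - x).
rewrite !(energyBl, energyBr) (energyC x (T t x)) => h2 h3.
set a := energy (T t x) x in h1 h2 *; set b := energy x x in h1 h2 h3 *.
have h4 : 2 * (t^-1 * (a - b)) <= - (hnorm x ^+ 2 - e / 2).
  rewrite mulrCA ler_pdivrMl//; lra.
move: h1; rewrite ltr_norml => /andP[_]; lra.
Qed.

End Lyapunov.

(** * Detectability implies the inequality *)

Section Detectability.
Context (R : realType) (k : scalars) (H Y : hilbertType R k).

(** With [K] a bound for the product of the norms of [F] and [P], Young's
    inequality gives [2 K |C x| |x| <= |x|^2 / 2 + 2 K^2 |C x|^2].  Taking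
    [eta = 1 / (2 K^2)] balances the last term against [|C x|^2]. *)
Lemma detectable_inequality (A : unbounded_op H) (C : 'L(H, Y)) :
  exponentially_detectable A C ->
  exists P : 'L(H, H), [/\ self_adjoint P, nonneg_op P &
    exists eta m : R, [/\ 0 < eta, 0 < m & detectability_inequality A C P eta m]].
Proof.
move=> [F [T [HT genT sqT]]].
have [P [Psa P0 PA]] := lyapunov_operator HT sqT genT.
exists P; split => //.
have [f f0 fP] := bop_le F; have [p p0 pP] := bop_le P.
have K0 : 0 < f * p by exact: mulr_gt0.
set K := f * p in K0.
have eta0 : 0 < (2 * K ^+ 2)^-1 by rewrite invr_gt0 mulr_gt0// exprn_gt0.
exists (2 * K ^+ 2)^-1, ((2 * K ^+ 2)^-1 / 2); split => //; first exact: divr_gt0.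
move=> x dx; have := PA x dx; rewrite /= rdotDl -/(rdot (A x) (P x)) => h.
have h1 : - (K * hnorm (C x) * hnorm x) <= rdot (F (C x)) (P x).
  rewrite lerNl -rdotNl (le_trans (rdot_le _ _))// hnormN.
  have -> : K * hnorm (C x) * hnorm x = f * hnorm (C x) * (p * hnorm x) by rewrite /K; ring.
  by rewrite ler_pM ?hnorm_ge0.
set eta := (2 * K ^+ 2)^-1 in eta0 *.
have etaK : eta * (2 * K ^+ 2) = 1 by rewrite mulVf// gt_eqF// mulr_gt0// exprn_gt0.
have h2 : eta * (hnorm x ^+ 2 / 2 - 2 * K ^+ 2 * hnorm (C x) ^+ 2) <=
    eta * (- 2 * rdot (A x) (P x)).
  rewrite ler_pM2l//; have := sqr_ge0 (2 * K * hnorm (C x) - hnorm x); nra.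
have -> : hnorm (C x) ^+ 2 = eta * (2 * K ^+ 2) * hnorm (C x) ^+ 2 by rewrite etaK mul1r.
lra.
Qed.

End Detectability.

(** * Dissipative generators *)

(** Subtract a line of small slope [a]: the resulting function decreases strictly
    to the right of each point of [[0, N)], so its minimum over [[0, N]] can
    only be attained at [N]. *)
Lemma right_dini_nonincreasing (R : realType) (psi : R -> R) (N : R) : 0 <= N ->
  {within `[0, N], continuous psi} ->
  (forall t e : R, 0 <= t < N -> 0 < e -> exists2 d : R, 0 < d &
     forall h : R, 0 < h < d -> psi (t + h) - psi t <= e * h) ->
  psi N <= psi 0.
Proof.
move=> N0 cpsi h; apply/ler_addgt0Pr => e e0.
pose a := e / (N + 1); have a0 : 0 < a by rewrite divr_gt0// ltr_wpDl.
pose g t := psi t - a * t.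
have cg : {within `[0, N], continuous g}.
  have ca : {within `[0, N], continuous (fun t : R => a * t)}.
    by apply: continuous_subspaceT => t; apply: cvgM => //; exact: cvg_cst.
  by move=> t; apply: cvgB; [exact: cpsi|exact: ca].
have [c] := EVT_min N0 cg.
rewrite in_itv /= => /andP[c0 cN] cmin.
have [cltN|Nlec] := ltP c N; last first.
  have cE : c = N by apply/le_anti; rewrite cN Nlec.
  have := cmin 0; rewrite in_itv /= lexx N0 => /(_ isT).
  rewrite cE /g mulr0 subr0 lerBlDr => /le_trans; apply; rewrite lerD2l.
  by rewrite /a mulrAC ler_pdivrMr ?ltr_wpDl// ler_wpM2l ?(ltW e0)// lerDl.
have a2 : 0 < a / 2 by rewrite divr_gt0.
have cI : 0 <= c < N by rewrite c0.
have [d d0 dP] := h c (a / 2) cI a2.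
pose s := Num.min d (N - c) / 2.
have m0 : 0 < Num.min d (N - c) by rewrite lt_min d0 subr_gt0.
have s0 : 0 < s by rewrite divr_gt0.
have sm : s < Num.min d (N - c) by rewrite ltr_pdivrMr// ltr_pMr// ltr1n.
move: sm; rewrite lt_min => /andP[sd sN].
have := dP s; rewrite s0 sd => /(_ isT) h1.
have := cmin (c + s); rewrite in_itv /= addr_ge0 ?(ltW s0)//= => /(_ _).
have -> : c + s <= N by lra.
move=> /(_ isT); rewrite /g => h2.
have := mulr_gt0 a0 s0; lra.
Qed.

Section DissipativeStability.
Context (R : realType) (k : scalars) (H : hilbertType R k).

Context (S : R -> 'L(H, H)) (HS : C0_semigroup S) (A : unbounded_op H)
  (genA : generates A S).

Lemma dom_invariant x (t : R) : 0 <= t -> dom A x -> dom A (S t x).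
Proof.
move=> t0 dx; rewrite (proj1 genA) /=; apply/cvg_ex; exists (S t (A x)).
have : S t (difference_quotient S x h) @[h --> 0^'+] --> S t (A x).
  by apply: bop_cvg; exact: (proj2 genA).
apply: cvg_trans; apply: near_eq_cvg; near=> h.
have h0 : 0 < h by [].
rewrite /difference_quotient linearZ linearB -!(sgD HS) ?(ltW h0)//.
by rewrite (addrC t).
Unshelve. all: by end_near. Qed.

(** The means [h^-1 * int_0^h S(s) x ds] lie in the domain and tend to [x] as [h]
    tends to [0]. *)
Lemma dom_dense x (e : R) : 0 < e -> exists2 y, dom A y & hnorm (y - x) < e.
Proof.
move=> e0.
pose f (t : R) := S `|t| x; have cf : continuous f := @sg_continuous _ _ _ _ HS x.
have f0 : f 0 = x by rewrite /f normr0 (sg0 HS).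
have mean (a d : R) : 0 < d -> 0 <= a -> exists2 r : R, 0 < r & forall h, 0 < h < r ->
    hnorm (sreal k h^-1 *: wint a (a + h) f - f a) <= d.
  move=> d0 a0; have /cvg_hnormP/(_ _ d0)[r /= r0 rP] := cf a.
  exists r => // h /andP[h0 hr].
  have -> : f a = sreal k h^-1 *: wint a (a + h) (fun=> f a).
    rewrite wint_cst ?lerDl ?ltW// scalerA -srealM addrC addKr mulVf ?gt_eqF//.
    by rewrite sreal1 scale1r.
  rewrite -scalerBr -wintN; last exact: cst_continuous.
  rewrite -wintD; [|exact: cf|exact: cst_continuous].
  have hi : 0 <= h^-1 by rewrite invr_ge0 ltW.
  rewrite hnorm_sreal (ger0_norm hi) ler_pdivrMl// mulrC.
  have -> : d * h = d * (a + h - a) by congr (_ * _); ring.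
  apply: wint_bound => [||s /andP[as_ sah]]; rewrite ?lerDl ?ltW//.
    by move=> s; apply: cvgB; [exact: cf|exact: cvg_cst].
  by apply: rP; rewrite /= distrC ger0_norm ?subr_ge0//; lra.
have e2 : 0 < e / 2 by rewrite divr_gt0.
have [r r0 rP] := mean 0 _ e2 (lexx _).
pose h := r / 2; have h0 : 0 < h by rewrite divr_gt0.
have hr : h < r by rewrite ltr_pdivrMr// ltr_pMr// ltr1n.
exists (sreal k h^-1 *: wint 0 h f); last first.
  have := rP h; rewrite h0 hr add0r f0 => /(_ isT) /le_lt_trans; apply.
  by rewrite ltr_pdivrMr// ltr_pMr// ltr1n.
set w := wint 0 h f.
have shift (t : R) : 0 < t -> S t w - w = wint h (h + t) f - wint 0 (0 + t) f.
  move=> t0; have : wint 0 (h + t) f = wint 0 t f + S t w.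
    rewrite (wint_chasles (b := t))// ?(ltW t0) ?lerDr ?(ltW h0)//.
    congr (_ + _); rewrite -{1}[t]add0r wint_shift// wint_bop//.
    apply: wint_ext => s /andP[s0 _].
    by rewrite /f !ger0_norm ?addr_ge0 ?(ltW t0)// addrC (sgD HS) ?(ltW t0).
  have -> : wint 0 (h + t) f = w + wint h (h + t) f.
    by rewrite /w -wint_chasles// ?(ltW h0) ?lerDl ?(ltW t0).
  rewrite add0r => e1.
  clearbody w; move: (wint h _ f) (wint 0 t f) e1 => U1 U2 e1.
  have -> : S t w = w + U1 - U2 by rewrite e1; hilbert_ring.
  by hilbert_ring.
rewrite (proj1 genA) /=; apply/cvg_ex; exists (sreal k h^-1 *: (f h - f 0)).
apply/cvg_hnormP => d d0.
have hi : 0 < h^-1 by rewrite invr_gt0.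
have d2 : 0 < d * h / 3 by rewrite divr_gt0// mulr_gt0.
have [r1 r10 r1P] := mean h _ d2 (ltW h0).
have [r2 r20 r2P] := mean 0 _ d2 (lexx _).
exists (Num.min r1 r2); first by rewrite /= lt_min r10.
move=> t /=; rewrite sub0r normrN => tr t0.
move: tr; rewrite (gtr0_norm t0) lt_min => /andP[tr1 tr2].
have -> : difference_quotient S (sreal k h^-1 *: w) t =
    sreal k h^-1 *: (sreal k t^-1 *: (S t w - w)).
  rewrite /difference_quotient -srealV linearZ -scalerBr !scalerA.
  by rewrite -!srealM mulrC.
rewrite -scalerBr hnorm_sreal (gtr0_norm hi) ltr_pdivrMl// shift//.
have := r1P t; rewrite t0 tr1 => /(_ isT) h1.
have := r2P t; rewrite t0 tr2 => /(_ isT) h2.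
have -> : sreal k t^-1 *: (wint h (h + t) f - wint 0 (0 + t) f) - (f h - f 0) =
   (sreal k t^-1 *: wint h (h + t) f - f h) - (sreal k t^-1 *: wint 0 (0 + t) f - f 0).
  by move: (wint h _ f) (wint 0 _ f) (f h) (f 0) => *; hilbert_ring.
rewrite (le_lt_trans (hnormB _ _))// (le_lt_trans (lerD h1 h2))// mulrC.
have := mulr_gt0 d0 h0; lra.
Qed.

Lemma sg_square_integrable x (c : R) :
  (forall N : R, 0 <= N -> rint 0 N (fun t => hnorm (S `|t| x) ^+ 2) <= c) ->
  square_integrable (fun t => S t x).
Proof.
move=> bnd.
pose f (t : measurableTypeR R) : R := hnorm (S `|t| x) ^+ 2.
have cf : continuous (f : R -> R).
  exact: continuous_sqr_hnorm (@sg_continuous _ _ _ _ HS x).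
have mf : measurable_fun setT f by exact: continuous_measurable_fun.
rewrite /square_integrable.
apply: (@eq_integrable _ _ _ lebesgue_measure _ _ (EFin \o f)) => //.
  by move=> t; rewrite inE /= in_itv /= andbT => t0; rewrite /f ger0_norm.
apply/integrableP; split; first exact/measurable_EFinP/measurable_funTS.
under eq_integral do rewrite /= ger0_norm ?sqr_ge0//.
have h := @ge0_cvgn_integral R lebesgue_measure f (fun t => sqr_ge0 _) mf.
apply: (@le_lt_trans _ _ c%:E); last exact: ltry.
rewrite -(cvg_lim _ h)//; apply: lime_le; first by apply/cvg_ex; eexists; exact: h.
apply: nearW => n; have := bnd n%:R (ler0n _ n).
rewrite -lee_fin /rint fineK//.
exact: integrable_fin_num (@rint_integrable _ _ _ _ cf).
Qed.

(** On the domain, [<P S(t) x, S(t) x>] plus [c] times the integral of [|S(s) x|^2]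
    over [[0, t]] has non-positive right derivative.  Only right derivatives
    are available directly from the definition of the generator. *)
Lemma dissipation_bound (P : 'L(H, H)) (c : R) (x : H) (N : R) : 0 < c ->
  self_adjoint P -> (forall y, 0 <= rdot (P y) y) ->
  (forall y, dom A y -> 2 * rdot (A y) (P y) <= - (c * hnorm y ^+ 2)) ->
  dom A x -> 0 <= N ->
  c * rint 0 N (fun t => hnorm (S `|t| x) ^+ 2) <= rdot (P x) x.
Proof.
move=> c0 /self_adjointP Psa P0 PA dx N0.
pose f (t : R) := S `|t| x.
have cf : continuous f := @sg_continuous _ _ _ _ HS x.
pose V (t : R) := rdot (P (f t)) (f t).
have cV : continuous V by move=> t; apply: cvg_rdot; [exact: continuous_bop|exact: cf].
pose q (t : R) := hnorm (f t) ^+ 2.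
have cq : continuous q by exact: continuous_sqr_hnorm.
pose psi (t : R) := V t + c * rint 0 t q.
have f0 : f 0 = x by rewrite /f normr0 (sg0 HS).
suff : psi N <= psi 0.
  rewrite /psi /V f0 /rint set_itv1 Rintegral_set1 mulr0 addr0.
  by apply: le_trans; rewrite lerDr P0.
apply: right_dini_nonincreasing => //.
  have crint : {within `[0, N], continuous (fun t => rint 0 t q)}.
    exact: (parameterized_integral_continuous N0 (rint_integrable 0 N cq)).
  move=> t; apply: cvgD; first exact: (continuous_subspaceT (A := `[0, N]) cV).
  by apply: cvgM; [exact: cvg_cst|exact: crint].
move=> t e /andP[t0 tN] e0.
have ft : f t = S t x by rewrite /f ger0_norm.
have dy : dom A (f t) by rewrite ft; exact: dom_invariant.
set y := f t in dy *.
have e2 : 0 < e / 2 by rewrite divr_gt0.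
have dqy : difference_quotient S y h @[h --> 0^'+] --> A y by exact: (proj2 genA).
have wy : (S h y - y) @[h --> 0^'+] --> (0 : H).
  rewrite -(subrr y); apply: cvgB; last exact: cvg_cst.
  by case: HS => _ _; apply.
have Glim : 2 * rdot (difference_quotient S y h) (P y) +
      rdot (P (difference_quotient S y h)) (S h y - y) @[h --> 0^'+] -->
    2 * rdot (A y) (P y) + rdot (P (A y)) 0.
  apply: cvgD; last by apply: cvg_rdot wy; apply: bop_cvg.
  by apply: cvgM; [exact: cvg_cst|apply: cvg_rdot dqy _; exact: cvg_cst].
move/cvgrPdist_lt : Glim => /(_ _ e2) [d1 /= d10 d1P].
have ec : 0 < e / 2 / c by rewrite divr_gt0.
have /cvgrPdist_lt/(_ _ ec)[d2 /= d20 d2P] := cq t.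
exists (Num.min d1 d2); first by rewrite lt_min d10.
move=> h /andP[h0]; rewrite lt_min => /andP[hd1 hd2].
have t0h : 0 <= t + h by rewrite addr_ge0// ltW.
have fth : f (t + h) = S h y.
  by rewrite /y ft /f ger0_norm// addrC (sgD HS) ?(ltW h0).
have Vdiff : V (t + h) - V t = h * (2 * rdot (difference_quotient S y h) (P y) +
      rdot (P (difference_quotient S y h)) (S h y - y)).
  rewrite /V fth -/y /difference_quotient -srealV linearZ !rdotZl !linearB !rdotBl !rdotBr.
  rewrite (Psa (S h y) y) (rdotC (P y) (S h y)) (rdotC (P y) y).
  by field; rewrite gt_eqF.
have rdiff : rint 0 (t + h) q - rint 0 t q <= (q t + e / 2 / c) * h.
  rewrite (rint_chasles (b := t))// ?lerDl ?(ltW h0)// addrC addKr.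
  have -> : (q t + e / 2 / c) * h = (q t + e / 2 / c) * (t + h - t) by congr (_ * _); ring.
  apply: rint_bound; rewrite ?lerDl ?(ltW h0)// => s /andP[ts sth].
  have := d2P s; rewrite /= distrC ger0_norm ?subr_ge0// => /(_ _)/ltW.
  rewrite ler_norml => h1; have /h1 /andP[+ _] : s - t < d2 by lra.
  lra.
have := d1P h; rewrite /= sub0r normrN gtr0_norm// => /(_ hd1 h0).
rewrite rdot0r addr0 distrC => /ltW/(le_trans (ler_norm _)).
set G := 2 * rdot (difference_quotient S y h) (P y) + _ in Vdiff *.
move=> G1; have PAy := PA y dy; rewrite -/(q t) in PAy.
have h2 : h * G <= h * (- (c * q t) + e / 2) by rewrite ler_wpM2l ?(ltW h0)//; lra.
have h3 := ler_wpM2l (ltW c0) rdiff.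
have cE : c * ((q t + e / 2 / c) * h) = h * (c * q t + e / 2).
  by field; rewrite gt_eqF.
rewrite cE in h3; rewrite /psi.
have -> : V (t + h) + c * rint 0 (t + h) q - (V t + c * rint 0 t q) =
  (V (t + h) - V t) + c * (rint 0 (t + h) q - rint 0 t q) by ring.
by rewrite Vdiff; lra.
Qed.

(** The bound of [dissipation_bound] is uniform in the horizon and depends
    continuously on [x], so that it extends from the dense domain to all of
    [H]. *)
Lemma dissipative_exponentially_stable (P : 'L(H, H)) (c : R) : 0 < c ->
  self_adjoint P -> (forall y, 0 <= rdot (P y) y) ->
  (forall y, dom A y -> 2 * rdot (A y) (P y) <= - (c * hnorm y ^+ 2)) ->
  exponentially_stable A.
Proof.
move=> c0 Psa P0 PA; exists S; split => // x.
apply: (@sg_square_integrable _ (rdot (P x) x / c)) => N N0.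
rewrite ler_pdivlMr// mulrC.
have /choice[u uP] (n : nat) : exists y, dom A y /\ hnorm (y - x) < n.+1%:R^-1.
  have [|y dy yx] := dom_dense x (e := n.+1%:R^-1); first by rewrite invr_gt0.
  by exists y.
have ux : u @ \oo --> x.
  apply/cvg_hnormP => e /invn_small[M HM]; exists M => // n /= /HM.
  by apply: lt_trans; have [] := uP n.
have [M M1 MP] := sg_bounded HS N.
have M0 : 0 <= M by rewrite (le_trans ler01).
pose d n := M * hnorm (u n - x).
pose r n := rdot (P (u n)) (u n) + c * N * (d n * (2 * (M * hnorm x) + d n)).
have rlim : r @ \oo --> rdot (P x) x.
  have dlim : d @ \oo --> (0 : R).
    rewrite -(mulr0 M); apply: cvgM; first exact: cvg_cst.
    rewrite -(hnorm0 H) -(subrr x); apply: cvg_hnorm.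
    by apply: cvgB => //; exact: cvg_cst.
  rewrite -[rdot (P x) x]addr0 -(mulr0 (c * N)) -(mul0r (2 * (M * hnorm x) + 0)).
  apply: cvgD; first by apply: cvg_rdot; [apply: bop_cvg; exact: ux|exact: ux].
  apply: cvgM; first exact: cvg_cst.
  by apply: cvgM => //; apply: cvgD => //; exact: cvg_cst.
apply: (cvgr_to_ge rlim); apply: nearW => n.
have [dun _] := uP n.
have := dissipation_bound c0 Psa P0 PA dun N0.
have cq z : continuous (fun t : R => hnorm (S `|t| z) ^+ 2).
  exact: continuous_sqr_hnorm (@sg_continuous _ _ _ _ HS z).
set K := d n * (2 * (M * hnorm x) + d n).
have le_int : rint 0 N (fun t => hnorm (S `|t| x) ^+ 2) <=
    rint 0 N (fun t => hnorm (S `|t| (u n)) ^+ 2) + K * N.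
  rewrite -[X in K * X]subr0 -rint_cst// -rintD//; last by move=> s; exact: cst_continuous.
  apply: rint_le => [//|s|s sN]; first by apply: cvgD; [exact: cq|exact: cvg_cst].
  have s0 : 0 <= s by case/andP: sN.
  rewrite ger0_norm//.
  have h1 : hnorm (S s (u n) - S s x) <= d n by rewrite -linearB MP.
  have h2 := hnorm_le_dist (S s x) (S s (u n)); rewrite hnorm_subC in h2.
  have h3 : hnorm (S s x) <= M * hnorm x by exact: MP.
  have h4 := hnorm_ge0 (S s x); have h5 := hnorm_ge0 (S s (u n)).
  have h6 := hnorm_ge0 (S s (u n) - S s x).
  have K1 : d n * (2 * hnorm (S s x)) <= K.
    rewrite /K ler_wpM2l//; first exact: le_trans h6 h1.
    have := le_trans h6 h1; lra.
  rewrite -lerBlDl subr_sqr (le_trans _ K1)//.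
  have [ab|ba] := leP (hnorm (S s x)) (hnorm (S s (u n))).
    apply: (@le_trans _ _ 0); last by rewrite !mulr_ge0 ?hnorm_ge0.
    by rewrite mulr_le0_ge0 ?subr_le0 ?addr_ge0.
  by rewrite ler_pM//; lra.
have := ler_wpM2l (ltW c0) le_int; rewrite /r -/K mulrDr => h1 h2.
by rewrite (le_trans h1)// (_ : c * (K * N) = c * N * K) ?lerD2r//; ring.
Qed.

End DissipativeStability.

(** * The inequality implies detectability *)

Section DetectabilityConverse.
Context (R : realType) (k : scalars) (H Y : hilbertType R k).

(** For each [y] the functionals [<C w, y> / |P w|], indexed by [w], are bounded by
    the norm of any [z] with [P z = C^* y].  Uniform boundedness makes this
    bound linear in [|y|], and [G y] is the Riesz vector of the functional
    [P w |-> <C w, y>] on the range of [P]. *)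
Lemma douglas_factor (P : 'L(H, H)) (C : 'L(H, Y)) :
  self_adjoint P -> range (adjoint C) `<=` range P ->
  exists G : 'L(Y, H), forall w y, rdot (P w) (G y) = rdot (C w) y.
Proof.
move=> /self_adjointP Psa ranC.
have pre y : exists z, forall w, rdot (C w) y = rdot (P w) z.
  have [z _ zy] := ranC (adjoint C y) (ex_intro2 _ _ y I erefl).
  by exists z => w; rewrite -adjointP -zy -Psa.
pose f (w : H) (y : Y) := `|rdot (C w) y| / hnorm (P w).
have [w x y|w c u y uy uc|y|r r0 [c cP]] := @uniform_boundedness R k Y H f.
- rewrite /f -mulrDl mulrA ler_wpM2r ?invr_ge0 ?hnorm_ge0//.
  rewrite rdotBr (le_trans (ler_normB _ _))//.
  by have := normr_ge0 (rdot (C w) x); have := normr_ge0 (rdot (C w) y); lra.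
- have fu : f w (u n) @[n --> \oo] --> f w y.
    apply: cvgM; last exact: cvg_cst.
    by apply: cvg_norm; apply: cvg_rdot; [exact: cvg_cst|exact: uy].
  by apply: (cvgr_to_le fu); exact: nearW.
- have [z zP] := pre y; exists (hnorm z) => w; rewrite /f zP.
  have [->|w0] := eqVneq (hnorm (P w)) 0; first by rewrite invr0 mulr0 hnorm_ge0.
  have wp : 0 < hnorm (P w) by exact: hnorm_gt0.
  by rewrite ler_pdivrMr// mulrC normr_rdot_le.
have c0 : 0 <= c.
  have := cP 0 0; rewrite hnorm0 (ltW r0) => /(_ isT); apply: le_trans.
  by rewrite /f rdot0r normr0 mul0r.
apply: (@riesz_bop_range R k H H Y P (fun w y => rdot (C w) y) (c / r)).
- by move=> y u v; rewrite linearD rdotDl.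
- by move=> u x y; rewrite rdotDr.
- by move=> t u y; rewrite linearZ rdotZl.
- by move=> a u y; rewrite linearZ rdot_conj.
- by rewrite divr_ge0// ltW.
move=> w y.
have [y0|y0] := eqVneq (hnorm y) 0; first by rewrite (hnorm_eq0 y0) rdot0r hnorm0 mulr0.
have yp : 0 < hnorm y by exact: hnorm_gt0.
have [w0|w0] := eqVneq (hnorm (P w)) 0.
  by have [z ->] := pre y; rewrite (hnorm_eq0 w0) rdot0l hnorm0 mulr0 mul0r.
have wp : 0 < hnorm (P w) by exact: hnorm_gt0.
have q0 : 0 <= r / hnorm y by rewrite divr_ge0 ?ltW.
have := cP w (sreal k (r / hnorm y) *: y).
rewrite hnorm_sreal (ger0_norm q0) divfK// => /(_ (lexx _)).
rewrite /f rdotZr normrM (ger0_norm q0) ler_pdivrMr// mulrAC ler_pdivrMr// => h.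
rewrite mulrAC -mulrA mulrAC ler_pdivlMr//.
have := ler_norm (rdot (C w) y); nra.
Qed.

(** The feedback [F = - (2 eta)^-1 G] with [P G = C^*] turns [2 eta Re <F C x, P x>]
    into [- |C x|^2], which cancels the indefinite term of the inequality. *)
Lemma inequality_detectable (A : unbounded_op H) (C : 'L(H, Y)) (P : 'L(H, H))
    (eta m : R) :
  (exists T : R -> 'L(H, H), C0_semigroup T /\ generates A T) ->
  self_adjoint P -> nonneg_op P -> range (adjoint C) `<=` range P ->
  0 < eta -> 0 < m -> detectability_inequality A C P eta m ->
  exponentially_detectable A C.
Proof.
move=> [T [HT genT]] Psa P0 ranC eta0 m0 ineq.
have [G GP] := douglas_factor Psa ranC.
pose a : scalar_field R k := sreal k (- (2 * eta)^-1).
have [g g0 gP] := bop_le G; have [c c0 cP] := bop_le C.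
have sn : 0 <= sRe `|a| by rewrite sRe_ge0.
have [||F FE] := @mk_bop R k Y H (fun y => a *: G y) (sRe `|a| * g).
- by move=> b y1 y2; rewrite linearP scalerDr !scalerA (mulrC a).
- by move=> y; rewrite hnormZ -mulrA ler_wpM2l.
have [||B BE] := @mk_bop R k H H (fun x => F (C x)) (sRe `|a| * g * c).
- by move=> b y1 y2; rewrite !linearP.
- move=> y; rewrite FE hnormZ -!mulrA ler_wpM2l// (le_trans (gP _))// ler_wpM2l ?(ltW g0)//.
have [S [HS genS]] := bounded_perturbation HT (Bf := F \o C) genT (fun x => esym (BE x)).
exists F; apply: (@dissipative_exponentially_stable _ _ _ S HS _ genS P (m / eta)) => //.
- exact: divr_gt0.
- by move=> y; apply: sRe_ge0.
move=> x /= dx; rewrite rdotDl FE rdotZl (rdotC (G _)) GP rdotxx.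
have := ineq x dx; rewrite -/(rdot (A x) (P x)) => h.
rewrite -(ler_pM2l eta0).
have -> : eta * - (m / eta * hnorm x ^+ 2) = - (m * hnorm x ^+ 2).
  by field; rewrite gt_eqF.
have -> : eta * (2 * (rdot (A x) (P x) + - (2 * eta)^-1 * hnorm (C x) ^+ 2)) =
    2 * eta * rdot (A x) (P x) - hnorm (C x) ^+ 2.
  by field; rewrite gt_eqF.
lra.
Qed.

End DetectabilityConverse.

Theorem theorem17 (R : realType) (k : scalars) (H Y : hilbertType R k)
    (A : unbounded_op H) (C : 'L(H, Y))
    (hA : exists T : R -> 'L(H, H), C0_semigroup T /\ generates A T) :
  (exponentially_detectable A C ->
     exists P : 'L(H, H),
       [/\ self_adjoint P, nonneg_op P &
           exists eta m : R,
             [/\ 0 < eta, 0 < m & detectability_inequality A C P eta m]]) /\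
  ((exists P : 'L(H, H),
      [/\ self_adjoint P, nonneg_op P, range (adjoint C) `<=` range P &
          exists eta m : R,
            [/\ 0 < eta, 0 < m & detectability_inequality A C P eta m]]) ->
   exponentially_detectable A C).
Proof.
split; first exact: detectable_inequality.
move=> [P [Psa P0 ranC [eta [m [eta0 m0 ineq]]]]].
exact: inequality_detectable hA Psa P0 ranC eta0 m0 ineq.
Qed.
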